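(* There exists a universal constant $b > 0$ such that the following holds for every integer $n \geq 1$, every finite group $G$ with $|G| \geq 2$, every probability measure $P$ on $G$ with $p_{\min} := \min_{g \in G} P(g) > 0$, and every $\vec{x}_0 \in G^n$. Let $\mathbf{W}$ be the Markov chain on $G \wr S_n$ (state space $G^n \times S_n$) described in the context, started at $(\vec{x}_0; e)$ and driven by $P$ and by the random-transpositions measure $\widehat{Q}$ defined by $$\widehat{Q}(e,\{j\}) := \frac{1}{n^2} \ \text{ for each } j \in [n], \qquad \widehat{Q}(\tau,\emptyset) := \frac{2}{n^2} \ \text{ for each transposition } \tau \in S_n, \qquad \widehat{Q}(\hat{\pi}) := 0 \ \text{ otherwise},$$ and let $\mathbf{P}$ be its transition matrix and $\mathbf{P}^{\infty}$ its stationary distribution. Let $k = \frac12 n \log n + \frac14 n \log\left( \frac{1}{p_{\min}} - 1 \right) + \frac12 c n$. Then $$\| \mathbf{P}^{k}((\vec{x}_0;e), \cdot) - \mathbf{P}^{\infty}(\cdot) \|_{\mathrm{TV}} \;\leq\; \tfrac12 \, \| \mathbf{P}^k((\vec{x}_0;e), \cdot) - \mathbf{P}^{\infty}(\cdot) \|_2 \;\leq\; b e^{-c} \qquad \text{for all } c > 0.$$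
   Context: Here $k$ is a number of steps, i.e. the statement concerns those $c > 0$ for which $k$ is an integer. Let $[n] = \{1,\ldots,n\}$, let $S_n$ be the symmetric group on $[n]$ with identity $e$, and for $\pi \in S_n$ let $F(\pi) \subseteq [n]$ be its set of fixed points. An augmented permutation is a pair $\hat{\pi} = (\pi, J)$ with $\pi \in S_n$ and $J \subseteq F(\pi)$; $\widehat{S}_n$ is the set of all of them, and $\widehat{Q}$ is a probability measure on $\widehat{S}_n$. Put $T(\pi,J) := \pi$ and $I(\pi,J) := ([n] \setminus F(\pi)) \cup J$. Write $p_g := P(g)$ for $g \in G$. (The group structure of $G$ plays no role.) The chain: let $\hat{\xi}_1, \hat{\xi}_2, \ldots$ be independent with law $\widehat{Q}$, and $\xi_k := T(\hat{\xi}_k)$. Set $Y_0 := e$, $Y_k := \xi_k \xi_{k-1} \cdots \xi_1$. Set $X_0 := \vec{x}_0 \in G^n$; at step $k \geq 1$, the entries of $X_{k-1}$ at the indices in $I(\hat{\xi}_k)$ are independently replaced by elements of $G$ with law $P$ (independently of everything else), the other entries being unchanged, to give $X_k$. The Markov chain is $\mathbf{W} = (W_k)_{k\ge 0}$, $W_k := (X_k; Y_k)$. Its transition matrix is $$\mathbf{P}((\vec{x};\pi),(\vec{y};\sigma)) = \sum_{\hat{\rho} \in \widehat{S}_n:\, T(\hat{\rho}) = \sigma\pi^{-1}} \widehat{Q}(\hat{\rho}) \prod_{j \in I(\hat{\rho})} p_{y_j} \prod_{\ell \notin I(\hat{\rho})} \mathbb{I}(x_\ell = y_\ell),$$ and its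 stationary distribution is $\mathbf{P}^{\infty}(\vec{x};\pi) = \frac{1}{n!}\prod_{i=1}^n p_{x_i}$. Norms: for a signed measure $\nu$ on $G^n \times S_n$, $\|\nu\|_2^2 := \sum_{w} \nu(w)^2 / \mathbf{P}^{\infty}(w)$. For probability measures $\nu_1,\nu_2$, $\|\nu_1 - \nu_2\|_{\mathrm{TV}} := \max_A |\nu_1(A) - \nu_2(A)|$. *)

(* Defs.v *)
From HB Require Import structures.
From mathcomp Require Import all_boot all_order all_fingroup all_algebra.
From mathcomp Require Import reals.

Set Implicit Arguments.
Unset Strict Implicit.
Unset Printing Implicit Defensive.

Import Order.TTheory GRing.Theory Num.Theory.

Local Open Scope ring_scope.

Section FiniteMeasures.
Variables (R : realType) (T : finType).

(* (Signed) measures on a finite set are represented by their mass functions. *)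
Definition is_prob (P : T -> R) : Prop :=
  (forall t, 0 <= P t) /\ \sum_t P t = 1.

Definition mass (nu : T -> R) (A : {set T}) : R := \sum_(t in A) nu t.

(* The initial value 0 is itself attained, at the empty event. *)
Definition tv_dist (nu1 nu2 : T -> R) : R :=
  \big[Num.max/0]_(A : {set T}) `|mass nu1 A - mass nu2 A|.

Definition l2_norm (pi nu : T -> R) : R :=
  Num.sqrt (\sum_t nu t ^+ 2 / pi t).

Definition kernel_mx (K : T -> T -> R) : 'M[R]_#|T| :=
  \matrix_(i, j) K (enum_val i) (enum_val j).

Definition kernel_iter (K : T -> T -> R) (k : nat) (s t : T) : R :=
  (kernel_mx K ^+ k) (enum_rank s) (enum_rank t).

End FiniteMeasures.

(* The initial value is one of the values of P, so this is their minimum. *)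
Definition p_min (R : realType) (G : finGroupType) (P : G -> R) : R :=
  \big[Num.min/P 1%g]_(g : G) P g.

Section AugmentedPermutations.
Variable n : nat.

Definition fixed_points (p : 'S_n) : {set 'I_n} := [set i | p i == i].

Definition aug_perm : Type :=
  {rho : 'S_n * {set 'I_n} | rho.2 \subset fixed_points rho.1}.

Definition augT (rho : aug_perm) : 'S_n := (val rho).1.

Definition augI (rho : aug_perm) : {set 'I_n} :=
  ~: fixed_points (augT rho) :|: (val rho).2.

Definition Qhat (R : realType) (rho : aug_perm) : R :=
  if [exists j : 'I_n, val rho == (1%g, [set j])] then 1 / n%:R ^+ 2
  else if [exists i : 'I_n, exists j : 'I_n,
             (i != j) && (val rho == (tperm i j, set0))] then 2 / n%:R ^+ 2
  else 0.

End AugmentedPermutations.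

Section Chain.
Variables (R : realType) (n : nat) (G : finGroupType) (P : G -> R).

Definition state : Type := ({ffun 'I_n -> G} * 'S_n)%type.

(* The product s * t of 'S_n applies s first, so that the permutation written
   sigma pi^-1 with functions composed from right to left is pi^-1 * sigma. *)
Definition transition (Q : aug_perm n -> R) (v w : state) : R :=
  \sum_(rho : aug_perm n | augT rho == (v.2^-1 * w.2)%g)
    Q rho * \prod_(j in augI rho) P (w.1 j)
          * \prod_(l | l \notin augI rho) (v.1 l == w.1 l)%:R.

Definition stationary (w : state) : R :=
  (n`!)%:R^-1 * \prod_(i < n) P (w.1 i).

End Chain.

(* Main.v *)
Require Import Defs.
From HB Require Import structures.
From mathcomp Require Import all_boot all_order all_fingroup all_algebra.
From mathcomp Require Import reals sequences exp.
From mathcomp Require Import complex mxred spectral.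
From mathcomp Require Import ring lra zify.

Set Implicit Arguments.
Unset Strict Implicit.
Unset Printing Implicit Defensive.

Import Order.TTheory GRing.Theory Num.Theory.

Local Open Scope ring_scope.

(** Independence of the refreshed coordinates turns the chain into a family of
    random transposition walks. Relative to the product weight of [P], the law at
    time [k] is a linear combination of the products, over sets [B] of indices, of
    the centred functions [[g = x0 l] / P g - 1]; the coefficient is the
    probability that the permutation is [s] and that no index of [B] has been
    refreshed ([density]). These products are orthogonal, with squared norm
    [\prod_(l in B) (1 / P (x0 l) - 1)], so the squared l2 distance is a sum over
    [B] ([law_error_l2]). The set [B = set0] gives the random transposition walk
    on all indices. For [#|B| = i > 0] the walk is confined to the [n - i] other
    points and has total mass [((n - i) / n) ^ (2 k)]; for the given [k] the term
    is at most [expR (- 2 c i) / i!], up to a constant factor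
    ([survival_term_le]), provided that the walk on [j <= n] points is itself
    close to uniform in l2 at time [(j ln j + c j) / 2].

    For that walk, the sum of squared masses is a normalized trace of an even
    power of the symmetric operator [Z f s = \sum_(a in C) \sum_(b in C)
    f (s * tperm a b)] ([trace_walk]), so one needs its eigenvalues with their
    multiplicities. They are controlled without the characters of the symmetric
    group. Let an eigenfunction have zero average over every left coset of [Sym A]
    for every [A] of size [r]. Average it over [Sym A] for [A] as large as
    possible with a nonzero result [h]. By maximality the sum over [a] in [A] of
    the translates of [h] by [tperm a b] is [- h] for every [b] outside [A]. So
    the Rayleigh quotient of [h] is known, except for the transpositions outside
    [A]; these are bounded once by Cauchy-Schwarz and once by expanding a sum of
    squares ([eigenvalue_level]). Hence an eigenvalue above the resulting
    bound has no eigenfunction satisfying the averaging conditions, so the number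
    of such eigenvalues is at most the number of conditions, which is
    ['C(j, i) * n! / (j - i)!] for [r = j - i] ([card_large_eig]). Multiplication
    by the sign maps an eigenvalue [d] to [2 j - d], which takes care of the
    negative ones. Level [0] gives the uniform distribution, and the sum over the
    levels [i >= 1] of [j ^ (2 i) / i!] times the power of the eigenvalue bound
    is at most a constant times [expR (- 2 c)] ([level_sum_bound]). *)

(** * Eigenvalues of the sum of transpositions *)

Lemma le_of_eq (R : numDomainType) (x y : R) : x = y -> x <= y.
Proof. by move=> ->. Qed.

Section TranspositionOperator.
Variables (R : realFieldType) (T : finType) (C : {set T}).
Implicit Types (A B : {set T}) (u v h : {perm T} -> R) (p s g : {perm T}) (L : R).

Definition swap_sum v s : R := \sum_(a in C) \sum_(b in C) v (s * tperm a b)%g.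

Definition is_eigen L v := forall s, swap_sum v s = L * v s.

Definition sym_inv A h := forall p s, p \in Sym A -> h (s * p)%g = h s.

(** In terms of Young diagrams, the killed functions are those built from the
    shapes whose first row has fewer than [r] boxes. *)
Definition killed (r : nat) v := forall A g,
  A \subset C -> #|A| = r -> \sum_(p in Sym A) v (g * p)%g = 0.

Definition shift_add A b h s : R := \sum_(a in b |: A) h (s * tperm a b)%g.

Lemma tperm_Sym A a b : a \in A -> b \in A -> tperm a b \in Sym A.
Proof.
move=> aA bA; rewrite inE; apply/subsetP=> x; rewrite inE.
by case: tpermP => [->|->|_ _]; rewrite ?eqxx.
Qed.

Lemma SymS A B : A \subset B -> Sym A \subset Sym B.
Proof. by move=> AB; apply/subsetP=> p; rewrite !inE => /subset_trans; apply. Qed.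

Lemma Sym_closed A p x : p \in Sym A -> (p x \in A) = (x \in A).
Proof. by rewrite inE => /perm_closed. Qed.

Lemma sumr_shift (f : {perm T} -> R) p : \sum_s f (s * p)%g = \sum_s f s.
Proof. by rewrite [RHS](reindex_inj (mulIg p)). Qed.

Lemma sumr_const_card A (x : R) : \sum_(a in A) x = #|A|%:R * x.
Proof. by rewrite sumr_const mulr_natl. Qed.

(** The set of transpositions of [C] is stable under conjugation by [Sym C],
    so that the operator commutes with right translation by [Sym C]. *)
Lemma swap_sum_shift v p s : p \in Sym C ->
  swap_sum (fun s => v (s * p)%g) s = swap_sum v (s * p)%g.
Proof.
move=> pC; rewrite /swap_sum.
rewrite [RHS](reindex_inj (@perm_inj _ p)) /=.
apply: eq_big => [a|a aC]; first by rewrite Sym_closed.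
rewrite [RHS](reindex_inj (@perm_inj _ p)) /=.
apply: eq_big => [b|b bC]; first by rewrite Sym_closed.
by congr v; rewrite -!mulgA; congr (_ * _)%g; rewrite -tpermJ conjgE !mulgA mulgV mul1g.
Qed.

(** Translation by [p] turns the condition at [A] into the condition at the
    image of [A] under [p]. *)
Lemma killed_shift r v p : p \in Sym C -> killed r v -> killed r (fun s => v (s * p)%g).
Proof.
move=> pC kv A g AC Ar.
have pAC : [set p x | x in A] \subset C.
  by apply/subsetP=> _ /imsetP[x xA ->]; rewrite Sym_closed // (subsetP AC).
have := kv _ (g * p)%g pAC; rewrite card_imset ?Ar; last exact: perm_inj.
move=> /(_ erefl) k0; rewrite -[RHS]k0 [RHS](reindex_inj (conjg_inj p)) /=.
apply: eq_big => [q|q qA].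
  rewrite !inE; apply/subsetP/subsetP => H x.
    rewrite inE => Hx; rewrite -(permKV p x); apply: imset_f; apply: H.
    rewrite inE; apply: contraNneq Hx => fx.
    by rewrite conjgE !permM fx permKV.
  rewrite inE => Hq; have := H (p x); rewrite inE conjgE !permM permK.
  rewrite (inj_eq perm_inj) => /(_ Hq) /imsetP[y yA /perm_inj ->].
  exact: yA.
by congr v; rewrite conjgE !mulgA mulgK.
Qed.

(** An invariant function is its own average over a subset of size [r]. *)
Lemma killed_inv0 r A h : A \subset C -> (r <= #|A|)%N -> sym_inv A h ->
  killed r h -> forall s, h s = 0.
Proof.
move=> AC rA ih kh s.
have [B BA Br] : exists2 B : {set T}, B \subset A & #|B| = r.
  have /subset_leq_card := subsetT A; move: rA; case/card_geqP => t [ut st tA] _.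
  exists [set x in t]; last by rewrite cardsE (card_uniqP ut).
  by apply/subsetP=> x; rewrite inE => /tA.
have := kh B s (subset_trans BA AC) Br.
rewrite (eq_bigr (fun=> h s)) => [|p /(subsetP (SymS BA)) pA]; last exact: ih.
rewrite sumr_const card_Sym => /eqP; rewrite mulrn_eq0.
by rewrite eqn0Ngt fact_gt0 => /eqP.
Qed.

(** On [A]-invariant functions [shift_add A b] is, up to a scalar, the average
    over [Sym (b |: A)]: the transpositions [tperm a b], with [a] in [b |: A],
    represent the cosets of [Sym A] in that group. *)
Lemma shift_add_inv A b h : b \notin A -> sym_inv A h -> sym_inv (b |: A) (shift_add A b h).
Proof.
move=> bA ih p s pA; rewrite /shift_add.
rewrite [LHS](reindex_inj (@perm_inj _ p)) /=.
apply: eq_big => [a|a]; first exact: Sym_closed.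
rewrite (Sym_closed _ pA) => aA.
have bb : b \in b |: A by rewrite setU11.
(* q fixes b, which makes it an element of Sym A. *)
pose q := (tperm a b * p * tperm (p a) b)%g.
have qA : q \in Sym A.
  have qb : q b = b by rewrite /q !permM tpermR tpermL.
  have : q \in Sym (b |: A).
    rewrite !groupM //; apply: tperm_Sym => //; by rewrite Sym_closed.
  rewrite !inE => /subsetP H; apply/subsetP=> x xq.
  by have /setU1P[e|//] := H x xq; move: xq; rewrite inE e qb eqxx.
rewrite -[RHS](ih q _ qA) /q !mulgA; congr h.
by rewrite -[(s * tperm a b * tperm a b)%g]mulgA tperm2 mulg1.
Qed.

Lemma shift_add_eigen L A b h : A \subset C -> b \in C ->
  is_eigen L h -> is_eigen L (shift_add A b h).
Proof.
move=> AC bC eh s; rewrite /shift_add.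
transitivity (\sum_(a in b |: A) swap_sum (fun s => h (s * tperm a b)%g) s).
  rewrite /swap_sum [RHS]exchange_big /=; apply: eq_bigr => c cC.
  by rewrite [RHS]exchange_big.
rewrite mulr_sumr; apply: eq_bigr => a aA.
rewrite swap_sum_shift ?eh //; apply: tperm_Sym => //.
by move: aA => /setU1P[->//|/(subsetP AC)].
Qed.

Lemma shift_add_killed r A b h : A \subset C -> b \in C ->
  killed r h -> killed r (shift_add A b h).
Proof.
move=> AC bC kh B g BC Br; rewrite /shift_add exchange_big /= big1 // => a aA.
apply: (killed_shift _ kh) => //; apply: tperm_Sym => //.
by move: aA => /setU1P[->//|/(subsetP AC)].
Qed.

(** An eigenfunction invariant under a set [A] that cannot be enlarged. The
    last equation says that averaging it over [Sym (b |: A)] gives [0]. *)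
Definition saturated L r A h := [/\ A \subset C, (#|A| < r)%N & exists s, h s != 0] /\
  [/\ is_eigen L h, sym_inv A h &
  forall b s, b \in C :\: A -> \sum_(a in A) h (s * tperm a b)%g = - h s].

(** Averaging over one more point preserves eigenvalue and killing, and an
    invariant function under [r] points is [0]. So the process of enlarging
    [A], started from the empty set, gets stuck before [#|A| = r], and it can
    only get stuck at a saturated function. *)
Lemma exists_saturated L r v : is_eigen L v -> killed r v -> (exists s, v s != 0) ->
  exists A h, saturated L r A h.
Proof.
move=> ev kv nv.
suff H : forall d A h, (r - #|A| < d)%N -> A \subset C -> (exists s, h s != 0) ->
    is_eigen L h -> killed r h -> sym_inv A h -> exists A h, saturated L r A h.
  apply: (H r.+1 set0 v) => //; rewrite ?cards0 ?subn0 ?sub0set //.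
  move=> p s; rewrite inE => /subsetP Hp; congr v; rewrite -[RHS]mulg1; congr (_ * _)%g.
  apply/permP=> x; rewrite perm1; apply/eqP; apply: contraT => xp.
  by have := Hp x xp; rewrite inE.
elim=> // d IH A h dA AC nh eh kh ih.
have Ar : (#|A| < r)%N.
  rewrite ltnNge; apply/negP => rA; case: nh => s.
  by rewrite (killed_inv0 AC rA ih kh) eqxx.
case: (boolP [exists b in C :\: A, exists s, shift_add A b h s != 0]).
  case/existsP => b /andP[] /[!inE] /andP[bA bC] /existsP nh'.
  apply: (IH (b |: A) (shift_add A b h)) => //.
  - rewrite cardsU1 bA; lia.
  - by apply/subsetP=> x /setU1P[->//|/(subsetP AC)].
  - exact: shift_add_eigen.
  - exact: shift_add_killed.
  - exact: shift_add_inv.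
move=> H; exists A, h; split; first by [].
split=> // b s bCA; move: (bCA); rewrite inE => /andP[bA bC].
have/existsPn/(_ b) := H; rewrite bCA /= => /existsPn/(_ s) /negPn/eqP.
rewrite /shift_add big_setU1 //= tperm1 mulg1 => /eqP.
by rewrite addrC addr_eq0 => /eqP.
Qed.

Section Rayleigh.
Variables (L : R) (r : nat) (A : {set T}) (h : {perm T} -> R).
Hypothesis sat : saturated L r A h.

Let m := #|A|.
Let D := C :\: A.
Let i := #|D|.
Let N := \sum_s h s ^+ 2.
Let E := \sum_(b in D) \sum_(b' in D) \sum_s h s * h (s * tperm b b')%g.

Lemma saturated_card : #|C| = (m + i)%N.
Proof.
case: sat => [[AC _ _] _].
by rewrite /m /i /D cardsD (setIidPr AC) subnKC ?subset_leq_card.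
Qed.

Lemma saturated_norm_gt0 : 0 < N.
Proof.
case: sat => [[_ _ [s hs]] _]; rewrite /N (bigD1 s) //=.
by rewrite ltr_pwDl ?exprn_even_gt0 ?sumr_ge0 // => t _; rewrite sqr_ge0.
Qed.

Lemma saturated_big_split (F : T -> R) : \sum_(a in C) F a = \sum_(a in A) F a + \sum_(a in D) F a.
Proof.
case: sat => [[AC _ _] _]; rewrite (big_setID A) /=; congr (_ + _).
by rewrite (setIidPr AC).
Qed.

(** Among the pairs of points of [C], those inside [A] act trivially and those
    with one point in [A] are evaluated by saturation; only the pairs outside
    [A] remain, in [E]. *)
Lemma saturated_rayleigh : L * N = (m%:R ^+ 2 - 2 * i%:R) * N + E.
Proof.
case: sat => [[AC _ _] [eh ih sh]].
transitivity (\sum_s h s * swap_sum h s).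
  by rewrite mulr_sumr; apply: eq_bigr => s _; rewrite eh; ring.
have -> : E = \sum_s h s * \sum_(b in D) \sum_(b' in D) h (s * tperm b b')%g.
  rewrite /E; under eq_bigr do rewrite exchange_big /=.
  rewrite exchange_big /=; apply: eq_bigr => s _; rewrite mulr_sumr.
  by apply: eq_bigr => b _; rewrite mulr_sumr.
rewrite mulr_sumr -big_split /=; apply: eq_bigr => s _.
suff -> : swap_sum h s = (m%:R ^+ 2 - 2 * i%:R) * h s
    + \sum_(b in D) \sum_(b' in D) h (s * tperm b b')%g by ring.
rewrite /swap_sum saturated_big_split.
under eq_bigr do rewrite saturated_big_split.
rewrite big_split /=.
under [X in _ + X]eq_bigr do rewrite saturated_big_split.
rewrite [X in _ + X]big_split /=.
have -> : \sum_(a in A) \sum_(b in A) h (s * tperm a b)%g = m%:R ^+ 2 * h s.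
  under eq_bigr => a aA do under eq_bigr => b bA do rewrite (ih _ _ (tperm_Sym aA bA)).
  by rewrite !sumr_const_card -/m; ring.
have -> : \sum_(a in A) \sum_(b in D) h (s * tperm a b)%g = - i%:R * h s.
  rewrite exchange_big /=; under eq_bigr => b bD do rewrite sh //.
  by rewrite sumr_const_card -/i; ring.
have -> : \sum_(a in D) \sum_(b in A) h (s * tperm a b)%g = - i%:R * h s.
  under eq_bigr => b bD do under eq_bigr do rewrite tpermC.
  under eq_bigr => b bD do rewrite sh //.
  by rewrite sumr_const_card -/i; ring.
ring.
Qed.

Lemma residual_le_card : E <= i%:R ^+ 2 * N.
Proof.
have H b b' : \sum_s h s * h (s * tperm b b')%g <= N.
  suff : 2 * \sum_s h s * h (s * tperm b b')%g <= N + N by lra.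
  have e : \sum_s h (s * tperm b b')%g ^+ 2 = N.
    exact: (sumr_shift (fun s => h s ^+ 2)).
  rewrite -{2}e mulr_sumr -big_split /=.
  apply: ler_sum => s _; have := sqr_ge0 (h s - h (s * tperm b b')%g); nra.
apply: (@le_trans _ _ (\sum_(b in D) \sum_(b' in D) N)).
  by apply: ler_sum => b _; apply: ler_sum => b' _.
by rewrite !sumr_const_card -/i mulrA -expr2.
Qed.

(** This is the nonnegativity of the sum over [a] in [A] of the squared norms
    of [h + \sum_(b in D) h (. * tperm a b)]. The cross terms are evaluated by
    saturation: [tperm a b * tperm a b'] is [tperm b b' * tperm a b], and the sum
    over [a] of the last factor acts as [-1]. This bound is the better one when
    [i] is large, the Cauchy-Schwarz bound when [i] is small. *)
Lemma residual_le_square : E <= (m%:R + m%:R * i%:R - i%:R) * N.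
Proof.
case: sat => [[AC _ _] [eh ih sh]].
pose U a s := h s + \sum_(b in D) h (s * tperm a b)%g.
have U0 : 0 <= \sum_(a in A) \sum_s U a s ^+ 2.
  by apply: sumr_ge0 => a _; apply: sumr_ge0 => s _; rewrite sqr_ge0.
have ED : E = i%:R * N +
   \sum_(b in D) \sum_(b' in D | b' != b) \sum_s h s * h (s * tperm b b')%g.
  rewrite /i /E -sum1_card natr_sum mulr_suml -big_split /=.
  apply: eq_bigr => b bD.
  rewrite (bigD1 b) //=; congr (_ + _); rewrite mul1r; apply: eq_bigr => s _.
  by rewrite tperm1 mulg1 -expr2.
have SQ a s : U a s ^+ 2 = h s ^+ 2 + 2 * (\sum_(b in D) h s * h (s * tperm a b)%g)
    + \sum_(b in D) \sum_(b' in D) h (s * tperm a b)%g * h (s * tperm a b')%g.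
  rewrite /U -[\sum_(b in D) h s * _]mulr_sumr.
  under [X in _ = _ + X]eq_bigr do rewrite -mulr_sumr.
  rewrite -mulr_suml; ring.
have cross b b' : b \in D -> b' \in D -> b' != b ->
    \sum_(a in A) \sum_s h (s * tperm a b)%g * h (s * tperm a b')%g
    = - \sum_s h s * h (s * tperm b b')%g.
  move=> bD b'D bb'; transitivity (\sum_(a in A) \sum_s h s * h (s * tperm b b' * tperm a b)%g).
    apply: eq_bigr => a aA; rewrite -[LHS](sumr_shift _ (tperm a b)).
    apply: eq_bigr => s _; rewrite -!mulgA tperm2 mulg1; congr (_ * h (s * _)%g).
    have -> : tperm b b' = (tperm a b' ^ tperm a b)%g.
      rewrite tpermJ tpermL tpermD //; first by apply: contraTneq b'D => <-; rewrite inE aA.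
      by rewrite eq_sym.
    by rewrite conjgE tpermV -!mulgA tperm2 mulg1.
  rewrite exchange_big -sumrN; apply: eq_bigr => s _.
  by rewrite -mulr_sumr sh // mulrN.
have cross_eq : \sum_(a in A) \sum_s \sum_(b in D) \sum_(b' in D)
      h (s * tperm a b)%g * h (s * tperm a b')%g = m%:R * i%:R * N - (E - i%:R * N).
  transitivity (\sum_(b in D) \sum_(b' in D) \sum_(a in A) \sum_s
      h (s * tperm a b)%g * h (s * tperm a b')%g).
    under eq_bigr do rewrite exchange_big /=.
    rewrite exchange_big /=; apply: eq_bigr => b _.
    under eq_bigr do rewrite exchange_big /=.
    by rewrite exchange_big.
  transitivity (\sum_(b in D) (m%:R * N
      - \sum_(b' in D | b' != b) \sum_s h s * h (s * tperm b b')%g)); last first.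
    by rewrite ED sumrB sumr_const_card -/i; ring.
  apply: eq_bigr => b bD; rewrite (bigD1 b) //=; congr (_ + _).
    rewrite -sumr_const_card; apply: eq_bigr => a _.
    rewrite -[RHS](sumr_shift _ (tperm a b)).
    by apply: eq_bigr => s _; rewrite expr2.
  rewrite -sumrN; apply: eq_bigr => b' /andP[b'D bb']; exact: cross.
suff : \sum_(a in A) \sum_s U a s ^+ 2 = m%:R * N - 2 * i%:R * N + m%:R * i%:R * N
   - (E - i%:R * N) by move=> e; move: U0; rewrite e; lra.
transitivity (\sum_(a in A) (N + 2 * \sum_s \sum_(b in D) h s * h (s * tperm a b)%g
   + \sum_s \sum_(b in D) \sum_(b' in D) h (s * tperm a b)%g * h (s * tperm a b')%g)).
  apply: eq_bigr => a _; rewrite mulr_sumr -!big_split /=.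
  by apply: eq_bigr => s _; exact: SQ.
rewrite !big_split /= cross_eq -!addrA; congr (_ + (_ + _)).
  by rewrite sumr_const_card -/m.
rewrite -mulr_sumr -mulrA -mulrN; congr (_ * _).
rewrite exchange_big /=; under eq_bigr do rewrite exchange_big /=.
rewrite mulr_sumr -sumrN; apply: eq_bigr => s _.
under eq_bigr => b bD do rewrite -mulr_sumr sh // mulrN.
by rewrite sumr_const_card -/i expr2; ring.
Qed.

End Rayleigh.

(** The two Rayleigh bounds. The number [m] plays the part of the length of the
    first row of a Young diagram; for [i <= m] the first bound is attained, by
    the shape with rows [m] and [i]. *)
Lemma eigenvalue_level L r v :
  is_eigen L v -> killed r v -> (exists s, v s != 0) ->
  exists m i : nat, [/\ #|C| = (m + i)%N, (m < r)%N,
    L <= (m%:R + i%:R) ^+ 2 - 2 * i%:R * (m%:R + 1) &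
    L <= m%:R * (m%:R + i%:R) + m%:R - 3 * i%:R].
Proof.
move=> ev kv nv; have [A [h sat]] := exists_saturated ev kv nv.
exists #|A|, #|C :\: A|; have N0 := saturated_norm_gt0 sat.
have eN := saturated_rayleigh sat; split; first exact: saturated_card sat.
- by case: sat => [[]].
- rewrite -(ler_pM2r N0) eN; apply: le_trans (lerD (lexx _) (residual_le_card A h)) _.
  by apply: le_of_eq; ring.
- rewrite -(ler_pM2r N0) eN; apply: le_trans (lerD (lexx _) (residual_le_square sat)) _.
  by apply: le_of_eq; ring.
Qed.

(** The analogue of the inequality between the character ratio at a
    transposition and the relative length of the first row. *)
Lemma killed_bound L r v :
  is_eigen L v -> killed r v -> (exists s, v s != 0) -> L <= (#|C| * r.-1)%:R.
Proof.
move=> ev kv nv; have [m [i [-> mr b1 b2]]] := eigenvalue_level ev kv nv.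
apply: (@le_trans _ _ ((m + i) * m)%:R); last first.
  by rewrite ler_nat leq_mul2l; apply/orP; right; lia.
have [h|h] := leqP m (3 * i).
  apply: (le_trans b2); rewrite natrM natrD.
  have : m%:R <= 3 * i%:R :> R by rewrite -natrM ler_nat.
  lra.
apply: (le_trans b1); rewrite natrM natrD.
have : i%:R <= m%:R :> R by rewrite ler_nat; lia.
have : 0 <= i%:R :> R by [].
nra.
Qed.

(** The first formula is sharp for small [i], where the multiplicities
    [j ^ (2 i) / i!] leave no room; for larger [i] the second one suffices. The
    case [i = 1] is set apart because its value [j ^ 2 - 2 j] is the spectral gap,
    which also small [j] must have. *)
Definition level_bound (j i : nat) : R :=
  if (4 * i <= j)%N || (i == 1)%N && (1 < j)%N then j%:R ^+ 2 - 2 * i%:R * (j%:R - i%:R + 1)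
  else j%:R * (j%:R - i%:R).

(** The quantity [i' (j - i' + 1)] is at least its value at [i] as long as
    [i' + i <= j]; beyond that range [m < i], and the second Rayleigh bound is
    smaller than needed. *)
Lemma killed_level_bound L i v : (0 < i <= #|C|)%N ->
  is_eigen L v -> killed (#|C| - i).+1 v -> (exists s, v s != 0) ->
  L <= level_bound #|C| i.
Proof.
move=> /andP[i0 iC] ev kv nv; rewrite /level_bound; case: ifPn => [i4|_]; last first.
  by have := killed_bound ev kv nv; rewrite natrM natrB.
have [m [i' [eC mr b1 b2]]] := eigenvalue_level ev kv nv.
have i1R : 1 <= i%:R :> R by rewrite ler1n.
have eCR : #|C|%:R = m%:R + i'%:R :> R by rewrite eC natrD.
have iiR : i%:R <= i'%:R :> R by rewrite ler_nat; lia.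
rewrite -eCR in b1 b2.
have [h|h] := leqP (i' + i) #|C|.
  have hR : i'%:R + i%:R <= #|C|%:R :> R by rewrite -natrD ler_nat.
  apply: (le_trans b1).
  have : 0 <= (i'%:R - i%:R) * (#|C|%:R + 1 - i'%:R - i%:R) :> R.
    by rewrite mulr_ge0 //; lra.
  nra.
have hR : m%:R + 1 <= i%:R :> R by rewrite -(natrD _ m 1) ler_nat; lia.
have m0 : 0 <= m%:R :> R by [].
apply: (le_trans b2); move/orP: i4 => [i4|/andP[/eqP i1 _]].
  have i4R : 4 * i%:R <= #|C|%:R :> R by rewrite -natrM ler_nat.
  nra.
rewrite i1 in hR *; have -> : m%:R = 0 :> R by lra.
have : 0 <= i'%:R :> R by [].
nra.
Qed.

Definition sgn_twist v s : R := (-1) ^+ odd_perm s * v s.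

(** A true transposition changes the sign while the [#|C|] terms with [a = b] do
    not. This reduces negative eigenvalues to positive ones. *)
Lemma sgn_twist_eigen L v : is_eigen L v -> is_eigen (2 * #|C|%:R - L) (sgn_twist v).
Proof.
move=> ev s; rewrite /sgn_twist.
have -> : (2 * #|C|%:R - L) * ((-1) ^+ s * v s)
    = (-1) ^+ s * (2 * #|C|%:R * v s - swap_sum v s).
  by rewrite ev; move: ((-1) ^+ s) (#|C|%:R) => e c; ring.
rewrite /swap_sum -[#|C|]sum1_card natr_sum mulr_sumr mulr_suml -sumrB mulr_sumr.
apply: eq_bigr => a aC; rewrite (bigD1 a) //= [in RHS](bigD1 a) //= tperm1 mulg1.
rewrite opprD addrA mulrDr; congr (_ + _); first by congr (_ * _); lra.
rewrite -sumrN mulr_sumr; apply: eq_bigr => b /andP[_ ba].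
by rewrite odd_permM odd_tperm eq_sym ba addbT signrN mulNr mulrN.
Qed.

End TranspositionOperator.

(** * Diagonalization and counting of eigenvalues *)

(** Over the complex numbers this is the spectral theorem for Hermitian
    matrices; the eigenvalues are real, and two real matrices that are similar
    over the complex numbers are similar over the reals. *)
Lemma real_symmetric_diagonalizable (R : rcfType) n (A : 'M[R]_n) : A^T = A ->
  exists V : 'M[R]_n, exists d : 'rV[R]_n, V \in unitmx /\ V *m A = diag_mx d *m V.
Proof.
move=> sA; pose AC := map_mx (real_complex R) A.
have rA : AC \is a mxOver Num.real.
  by apply/mxOverP => i j; rewrite mxE complex_real.
have hA : AC \is hermsymmx.
  apply: realsym_hermsym => //; apply/is_hermitianmxP.
  by rewrite expr0 scale1r; apply/matrixP => i j; rewrite !mxE -{1}sA mxE.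
have /orthomx_spectralP eA := hermitian_normalmx hA.
have rd := hermitian_spectral_diag_real hA.
have [P /andP[rP uP] eP] : exists2 P, P \in [predI mxOver Num.real & unitmx] &
    similar_to P AC (PredOfSimpl.coerce (pred1 (diag_mx (spectral_diag AC)))).
  apply: real_similar => //.
    exists (spectralmx AC); first exact: spectral_unit.
    apply/similarP; first exact: spectral_unit.
    by rewrite {2}eA !mulmxA mulmxV ?spectral_unit // mul1mx.
  apply/mxOverP => i j; rewrite mxE; case: eqP => _; rewrite ?mulr1n ?mulr0n //.
  exact/mxOverP.
have reK m p (B : 'M[complex R]_(m, p)) : B \is a mxOver Num.real ->
    map_mx (real_complex R) (map_mx (@complex.Re R) B) = B.
  by move=> rB; apply/matrixP => i j; rewrite !mxE RRe_real //; exact: (mxOverP rB).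
exists (map_mx (@complex.Re R) P), (map_mx (@complex.Re R) (spectral_diag AC)); split.
  by rewrite -(map_unitmx (real_complex R)) reK.
move/(similarP uP): eP => eP.
have inj : injective (map_mx (real_complex R) : 'M[R]_n -> 'M[complex R]_n).
  by apply: map_mx_inj; exact: complexI.
by apply: inj; rewrite !map_mxM map_diag_mx !reK.
Qed.

Section Diagonalized.
Variables (F : fieldType) (n : nat) (A V : 'M[F]_n) (d : 'rV[F]_n).
Hypothesis VA : V *m A = diag_mx d *m V.

Lemma mxtrace_exp_diag t : V \in unitmx -> \tr (A ^+ t) = \sum_l d 0 l ^+ t.
Proof.
move=> uV; have VAt : V *m A ^+ t = diag_mx (\row_l d 0 l ^+ t) *m V.
  elim: t => [|t IH].
    rewrite expr0 mulmx1 -[LHS]mul1mx; congr (_ *m _); rewrite -diag_const_mx; congr diag_mx.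
    by apply/rowP => l; rewrite !mxE expr0.
  rewrite exprSr -mulmxE mulmxA IH -mulmxA VA mulmxA; congr (_ *m _).
  rewrite mulmx_diag; congr diag_mx; by apply/rowP => l; rewrite !mxE exprSr.
have -> : A ^+ t = invmx V *m (diag_mx (\row_l d 0 l ^+ t) *m V).
  by rewrite -VAt mulmxA mulVmx // mul1mx.
rewrite mxtrace_mulC -mulmxA mulmxV // mulmx1 mxtrace_diag.
by apply: eq_bigr => l _; rewrite mxE.
Qed.

(** Inside a stable subspace given by linear constraints [M], applying
    [A - d 0 l] to a vector removes the coordinate [l] and adds none. When the
    support cannot be reduced further, all its eigenvalues agree. *)
Lemma stable_eigenvector m (M : 'M[F]_(n, m)) (c : 'rV[F]_n) :
  (forall v : 'rV[F]_n, v *m M = 0 -> v *m A *m M = 0) ->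
  c != 0 -> c *m V *m M = 0 ->
  exists c' : 'rV[F]_n, exists l, [/\ c' != 0, c 0 l != 0, c' *m V *m M = 0 &
    c' *m V *m A = d 0 l *: (c' *m V)].
Proof.
move=> stM; have [k] := ubnP #|[set l | c 0 l != 0]|.
elim: k c => // k IH c ck c0 cM.
have /rV0Pn[l cl] := c0.
case: (boolP [forall l', (c 0 l' != 0) ==> (d 0 l' == d 0 l)]) => [/forallP H|].
  exists c, l; split=> //; rewrite -mulmxA VA mulmxA scalemxAl; congr (_ *m _).
  apply/rowP => l'; rewrite mul_mx_diag !mxE mulrC.
  by have := H l'; have [->|_ /= /eqP ->] := eqVneq (c 0 l') 0; rewrite ?mulr0.
rewrite negb_forall => /existsP[l']; rewrite negb_imply => /andP[cl' dl].
pose c2 := c *m diag_mx d - d 0 l *: c.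
have c2E j : c2 0 j = (d 0 j - d 0 l) * c 0 j by rewrite /c2 mul_mx_diag !mxE; ring.
have [|||c' [j [c'0 cj c'M c'A]]] := IH c2.
- rewrite -ltnS; apply: leq_trans ck; rewrite ltnS; apply/proper_card/properP; split.
    by apply/subsetP => j; rewrite !inE c2E mulf_eq0 negb_or => /andP[].
  by exists l; rewrite !inE ?c2E ?subrr ?mul0r ?eqxx.
- by apply/rV0Pn; exists l'; rewrite c2E mulf_neq0 // subr_eq0.
- rewrite /c2 !mulmxBl -[c *m _ *m V]mulmxA -VA mulmxA (stM _ cM).
  by rewrite -!scalemxAl cM scaler0 subr0.
exists c', j; split=> //; by move: cj; rewrite c2E mulf_eq0 negb_or => /andP[].
Qed.

(** If no eigenvector for an eigenvalue indexed by [L] satisfies the [m]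
    constraints, then the span of those eigenvectors meets the constrained
    subspace trivially, so its dimension is at most [m]. *)
Lemma card_unconstrained_eig m (M : 'M[F]_(n, m)) (L : {set 'I_n}) :
  (forall v : 'rV[F]_n, v *m M = 0 -> v *m A *m M = 0) -> V \in unitmx ->
  (forall (v : 'rV[F]_n) l, l \in L -> v != 0 -> v *m M = 0 -> v *m A = d 0 l *: v -> False) ->
  (#|L| <= m)%N.
Proof.
move=> stM uV HL; rewrite leqNgt; apply/negP => mL.
pose W := rowsub (fun i : 'I_#|L| => enum_val i) (V *m M).
have /rowV0Pn[b bW b0] : kermx W != 0.
  rewrite kermx_eq0; apply: contraTN mL => /eqP rW.
  by rewrite -leqNgt -rW rank_leq_col.
have {}bW : b *m W = 0 by apply/sub_kermxP.
pose E := rowsub (fun i : 'I_#|L| => enum_val i) (1%:M : 'M[F]_n).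
have cE j : (b *m E) 0 j = \sum_i b 0 i * (enum_val i == j)%:R.
  by rewrite mxE; apply: eq_bigr => i _; rewrite !mxE.
have cM : b *m E *m V *m M = 0.
  have EW : E *m (V *m M) = W by rewrite /E mul_rowsub_mx mul1mx.
  by rewrite -!mulmxA EW.
have c0 : b *m E != 0.
  have /rV0Pn[i bi] := b0; apply/rV0Pn; exists (enum_val i); rewrite cE (bigD1 i) //=.
  rewrite eqxx mulr1 big1 ?addr0 // => j ji.
  by rewrite (inj_eq enum_val_inj) (negPf ji) mulr0.
have [c' [l [c'0 cl c'M c'A]]] := stable_eigenvector stM c0 cM.
apply: (HL (c' *m V) l) => //.
  apply: contraNT cl => lL; rewrite cE big1 // => i _.
  by case: eqP => [e|]; rewrite ?mulr0 //; rewrite -e enum_valP in lL.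
apply: contraNneq c'0 => e; by rewrite -(mulmxK uV c') e mul0mx.
Qed.

End Diagonalized.

(** * The trace of powers of the transposition operator *)

(** Each positive [y l] is charged to the first level [i] with
    [B i.+1 < y l], at which [y l <= B i] still holds. *)
Lemma sum_pos_parts_le (R : realFieldType) (I : finType) (y : I -> R) (j t : nat)
    (B : nat -> R) (D : nat -> nat) :
  (0 < t)%N -> (forall i, (i <= j)%N -> 0 <= B i) -> B j = 0 ->
  (forall l, y l <= B 0%N) ->
  (forall i, (i < j)%N -> (#|[set l | (B i.+1 < y l)%R]| <= D i)%N) ->
  \sum_l Num.max (y l) 0 ^+ t <= \sum_(i < j) (D i)%:R * B i ^+ t.
Proof.
move=> t0 B0 Bj yB HD.
apply: (@le_trans _ _ (\sum_(i < j) \sum_(l in [set l | B i.+1 < y l]) B i ^+ t)); last first.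
  apply: ler_sum => i _; rewrite sumr_const -[leLHS]mulr_natl.
  by rewrite ler_wpM2r ?exprn_ge0 ?B0 ?ler_nat ?HD // ltnW.
under [leRHS]eq_bigr do rewrite big_mkcond /=.
rewrite [leRHS]exchange_big /=; apply: ler_sum => l _.
have Bt i : (i < j)%N -> 0 <= B i ^+ t by move=> ij; rewrite exprn_ge0 // B0 // ltnW.
have S0 : 0 <= \sum_(i < j) (if l \in [set l | B i.+1 < y l] then B i ^+ t else 0).
  by apply: sumr_ge0 => i _; case: ifP => // _; rewrite Bt.
have [y0|y0] := leP (y l) 0; first by rewrite expr0n eqn0Ngt t0.
have j0 : (0 < j)%N.
  by rewrite lt0n; apply: contraTneq y0 => e; rewrite -leNgt -Bj e.
have ex : exists i, (i < j)%N && (B i.+1 < y l).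
  by exists j.-1; rewrite prednK // leqnn Bj.
case: (ex_minnP ex) => i /andP[ij Bi] imin.
rewrite (bigD1 (Ordinal ij)) //= inE Bi -[leLHS]addr0 lerD //.
  apply: lerXn2r; rewrite ?nnegrE; [exact: ltW | exact/B0/ltnW |].
  case: i ij Bi imin => [|i] ij Bi imin; first exact: yB.
  rewrite leNgt; apply/negP => lt; have := imin i; rewrite lt (ltnW ij) ltnn.
  by move=> /(_ isT).
by apply: sumr_ge0 => i' _; case: ifP => // _; rewrite Bt.
Qed.

Lemma row_diag_mul (R : comRingType) n p (d : 'rV[R]_n) (B : 'M_(n, p)) l :
  row l (diag_mx d *m B) = d 0 l *: row l B.
Proof. by rewrite row_mul row_diag_mx -scalemxAl -rowE. Qed.

(** The number of averaging conditions over the left cosets of [Sym A], for [A]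
    running over the [(j - i)]-subsets of a [j]-set inside an [n]-set. *)
Definition level_dim (n j i : nat) : nat := 'C(j, i) * (n`! %/ (j - i)`!).

Section SwapMatrix.
Variables (R : rcfType) (T : finType) (C : {set T}).
Local Notation N := #|{: {perm T}}|.
Implicit Types (v : 'rV[R]_N) (r : nat).

Definition swap_mx : 'M[R]_N :=
  \matrix_(i, j) \sum_(a in C) \sum_(b in C) (enum_val j == enum_val i * tperm a b)%g%:R.

Definition row_fun v (s : {perm T}) : R := v 0 (enum_rank s).

Lemma row_funP v w : row_fun v =1 row_fun w -> v = w.
Proof. by move=> e; apply/rowP => j; rewrite -[j]enum_valK; exact: e. Qed.

Lemma row_fun_swap v s : row_fun (v *m swap_mx) s = swap_sum C (row_fun v) s.
Proof.
rewrite /row_fun !mxE /swap_sum.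
under eq_bigr do rewrite mxE mulr_sumr enum_rankK.
rewrite exchange_big /=; apply: eq_bigr => a _.
under eq_bigr do rewrite mulr_sumr.
rewrite exchange_big /=; apply: eq_bigr => b _.
rewrite (bigD1 (enum_rank (s * tperm a b)%g)) //= enum_rankK.
rewrite -mulgA tperm2 mulg1 eqxx mulr1 big1 ?addr0 // => i ni.
case: eqP => [e|]; rewrite ?mulr0 //.
by rewrite e -mulgA tperm2 mulg1 enum_valK eqxx in ni.
Qed.

Lemma swap_mx_sym : swap_mx^T = swap_mx.
Proof.
apply/matrixP => i j; rewrite !mxE; apply: eq_bigr => a _; apply: eq_bigr => b _.
congr (_%:R); apply: congr1; apply/eqP/eqP => ->; by rewrite -mulgA tperm2 mulg1.
Qed.

Lemma row_fun_eigen v L : (v *m swap_mx = L *: v) <-> is_eigen C L (row_fun v).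
Proof.
split=> [e s|e]; first by rewrite -row_fun_swap e /row_fun mxE.
by apply: row_funP => s; rewrite row_fun_swap e /row_fun mxE.
Qed.

Lemma row_fun_neq0 v : v != 0 -> exists s, row_fun v s != 0.
Proof. by move=> /rV0Pn[i vi]; exists (enum_val i); rewrite /row_fun enum_valK. Qed.

Definition constraints r : {set {set T} * {set {perm T}}} :=
  [set k : {set T} * {set {perm T}} |
    [&& k.1 \subset C, #|k.1| == r & k.2 \in lcosets (Sym k.1) setT]].

Lemma card_constraints r : #|constraints r| = ('C(#|C|, r) * (#|T|`! %/ r`!))%N.
Proof.
rewrite -sum1_card (eq_bigl (fun k : {set T} * {set {perm T}} => ((k.1 \subset C) && (#|k.1| == r))
   && (k.2 \in lcosets (Sym k.1) setT))); last by move=> k; rewrite inE andbA.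
rewrite -(pair_big_dep (fun A : {set T} => (A \subset C) && (#|A| == r))
  (fun A X => X \in lcosets (Sym A) setT) (fun _ _ => 1%N)) /=.
rewrite (eq_bigr (fun=> #|T|`! %/ r`!)%N) => [|A /andP[_ /eqP <-]]; last first.
  rewrite sum1_card card_lcosets -divgS ?subsetT // card_Sym; congr (_ %/ _)%N.
  transitivity #|Sym [set: T]|; last by rewrite card_Sym cardsT.
  by apply: eq_card => p; rewrite !inE; apply/esym/subsetP => x; rewrite inE.
by rewrite sum_nat_const -cards_draws; congr (_ * _)%N; apply: eq_card => A; rewrite !inE.
Qed.

Definition constraint_mx r : 'M[R]_(N, #|constraints r|) :=
  \matrix_(i < N, k < #|constraints r|)
    ((enum_val i : {perm T}) \in (enum_val k : {set T} * {set {perm T}}).2)%:R.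

Lemma constraint_mxP r v : v *m constraint_mx r = 0 <-> killed C r (row_fun v).
Proof.
have kE k : (v *m constraint_mx r) 0 k = \sum_(s in (enum_val k).2) row_fun v s.
  rewrite mxE [LHS](reindex _ (onW_bij _ (@enum_rank_bij {perm T}))) [RHS]big_mkcond /=.
  by apply: eq_bigr => s _; rewrite mxE enum_rankK /row_fun; case: ifP; rewrite ?mulr1 ?mulr0.
have lc A g : \sum_(s in (g *: Sym A)%g) row_fun v s = \sum_(p in Sym A) row_fun v (g * p)%g.
  by rewrite -lcosetE big_imset //= => x y _ _; exact: mulgI.
split=> [v0 A g AC Ar|kv].
  have kin : (A, g *: Sym A)%g \in constraints r.
    rewrite inE /= AC Ar eqxx /=; apply/lcosetsP; exists g => //; by rewrite inE.
  by have := kE (enum_rank_in kin (A, g *: Sym A)%g); rewrite v0 mxE enum_rankK_in //= lc.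
apply/rowP => k; rewrite kE mxE.
have := enum_valP k; rewrite inE => /and3P[AC /eqP Ar /lcosetsP[g _ ->]].
by rewrite lc kv.
Qed.

Lemma constraint_stable r v :
  v *m constraint_mx r = 0 -> v *m swap_mx *m constraint_mx r = 0.
Proof.
move=> /constraint_mxP kv; apply/constraint_mxP => A g AC Ar.
under eq_bigr do rewrite row_fun_swap.
rewrite /swap_sum exchange_big big1 //= => a aC; rewrite exchange_big big1 //= => b bC.
apply: (killed_shift _ kv) => //; exact: tperm_Sym.
Qed.

Lemma card_large_eig (V : 'M[R]_N) (d : 'rV[R]_N) i :
  V \in unitmx -> V *m swap_mx = diag_mx d *m V -> (i < #|C|)%N ->
  (#|[set l | (level_bound R #|C| i.+1 < d 0 l)%R]| <= 'C(#|C|, i) * (#|T|`! %/ (#|C| - i)`!))%N.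
Proof.
move=> uV VA iC; rewrite -(bin_sub (ltnW iC)) -card_constraints.
apply: (card_unconstrained_eig VA (@constraint_stable _) uV) => v l.
rewrite inE => ltd /row_fun_neq0 v0 /constraint_mxP kv /row_fun_eigen ev.
move: ltd; rewrite ltNge => /negP; apply; apply: killed_level_bound ev _ v0 => //.
by rewrite subnSK.
Qed.

Lemma diag_row_eigen (V : 'M[R]_N) (d : 'rV[R]_N) l :
  V *m swap_mx = diag_mx d *m V -> is_eigen C (d 0 l) (row_fun (row l V)).
Proof. by move=> VA; apply/row_fun_eigen; rewrite -row_mul VA row_diag_mul. Qed.

Lemma diag_le (V : 'M[R]_N) (d : 'rV[R]_N) l :
  V \in unitmx -> V *m swap_mx = diag_mx d *m V -> d 0 l <= (#|C| ^ 2)%:R.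
Proof.
move=> uV VA; rewrite -mulnn.
apply: (killed_bound (r := #|C|.+1) (diag_row_eigen l VA)).
  by move=> A g AC Ar; have := subset_leq_card AC; rewrite Ar ltnn.
apply: row_fun_neq0; apply: contraTneq uV => V0.
rewrite -row_free_unit -kermx_eq0; apply/rowV0Pn; exists (delta_mx 0 l); last first.
  by apply/rV0Pn; exists l; rewrite mxE !eqxx oner_eq0.
by apply/sub_kermxP; rewrite -rowE.
Qed.

Definition sgn_mx : 'M[R]_N := diag_mx (\row_i (-1) ^+ odd_perm (enum_val i)).

Lemma row_fun_sgn v s : row_fun (v *m sgn_mx) s = sgn_twist (row_fun v) s.
Proof. by rewrite /row_fun /sgn_twist mul_mx_diag !mxE enum_rankK mulrC. Qed.

Lemma sgn_mx_unit : sgn_mx \in unitmx.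
Proof.
have : sgn_mx *m sgn_mx = 1%:M.
  rewrite mulmx_diag -diag_const_mx; congr diag_mx; apply/rowP => i.
  by rewrite !mxE -expr2 sqrr_sign.
by case/mulmx1_unit.
Qed.

Lemma sgn_diag (V : 'M[R]_N) (d : 'rV[R]_N) : V *m swap_mx = diag_mx d *m V ->
  (V *m sgn_mx) *m swap_mx = diag_mx (\row_l (2 * #|C|%:R - d 0 l)) *m (V *m sgn_mx).
Proof.
move=> VA; apply/row_matrixP => l; rewrite row_diag_mul !row_mul mxE.
apply/row_fun_eigen => s; have := sgn_twist_eigen (diag_row_eigen l VA) s.
rewrite row_fun_sgn => <-; apply: eq_bigr => a _; apply: eq_bigr => b _.
exact: row_fun_sgn.
Qed.

Lemma level_bound_ge0 j i : (i <= j)%N -> 0 <= level_bound R j i.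
Proof.
move=> ij; have ijR : i%:R <= j%:R :> R by rewrite ler_nat.
have i0 : 0 <= i%:R :> R by [].
rewrite /level_bound; case: ifPn => [/orP i4|_]; last by rewrite mulr_ge0 ?subr_ge0.
have [->|i1] := posnP i; first by rewrite mulr0 mul0r subr0 sqr_ge0.
have i1R : 1 <= i%:R :> R by rewrite ler1n.
case: i4 => [i4|/andP[/eqP-> j1]].
  have i4R : 4 * i%:R <= j%:R :> R by rewrite -natrM ler_nat.
  nra.
have j1R : 2 <= j%:R :> R by rewrite ler_nat.
nra.
Qed.

Lemma level_bound_last j : (0 < j)%N -> level_bound R j j = 0.
Proof. by move=> j0; rewrite /level_bound ifF ?subrr ?mulr0 //; lia. Qed.

(** Even powers are the sum of the powers of the positive and negative parts of
    the eigenvalues, and each part is bounded by levels. The negative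
    eigenvalues are [2 j - d'] for eigenvalues [d'] of the twisted family, which
    replaces the top value [j ^ 2] by [j ^ 2 - 2 j]. *)
Lemma trace_swap_bound k : (0 < k)%N -> (0 < #|C|)%N ->
  \tr (swap_mx ^+ (2 * k)) <=
    (level_dim #|T| #|C| 0%N)%:R * ((#|C| ^ 2)%:R ^+ (2 * k)
      + Num.max ((#|C| ^ 2)%:R - 2 * #|C|%:R) 0 ^+ (2 * k))
    + 2 * \sum_(1 <= i < #|C|) (level_dim #|T| #|C| i)%:R * level_bound R #|C| i ^+ (2 * k).
Proof.
move=> k0 j0; set j := #|C|; pose D := level_dim #|T| j; rewrite -/D.
have [V [d [uV VA]]] := real_symmetric_diagonalizable swap_mx_sym.
rewrite (mxtrace_exp_diag VA _ uV).
have t0 : (0 < 2 * k)%N by rewrite muln_gt0.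
pose B (b : R) i := if i is 0%N then b else level_bound R j i.
have Bj b : B b j = 0.
  by rewrite -(level_bound_last j0) /B /j; case: #|C| j0.
have sumB b : \sum_(i < j) (D i)%:R * B b i ^+ (2 * k) =
    (D 0%N)%:R * b ^+ (2 * k) + \sum_(1 <= i < j) (D i)%:R * level_bound R j i ^+ (2 * k).
  rewrite -(big_mkord xpredT (fun i => (D i)%:R * B b i ^+ (2 * k))) big_ltn //=.
  by congr (_ + _); apply: eq_big_nat => -[].
have pos : \sum_l Num.max (d 0 l) 0 ^+ (2 * k)
    <= \sum_(i < j) (D i)%:R * B (j ^ 2)%:R i ^+ (2 * k).
  apply: sum_pos_parts_le => //.
  - by case=> // i; exact: level_bound_ge0.
  - by move=> l; exact: diag_le uV VA.
  - by move=> i ij; exact: (card_large_eig uV VA ij).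
have uV' : V *m sgn_mx \in unitmx by rewrite unitmx_mul uV sgn_mx_unit.
have VA' := sgn_diag VA.
have neg : \sum_l Num.max (- d 0 l) 0 ^+ (2 * k)
    <= \sum_(i < j) (D i)%:R * B (Num.max ((j ^ 2)%:R - 2 * j%:R) 0) i ^+ (2 * k).
  apply: sum_pos_parts_le => //.
  - case=> [_|i]; [by rewrite /B le_max lexx orbT | exact: level_bound_ge0].
  - move=> l; rewrite /B le_max; apply/orP; left.
    by have := diag_le l uV' VA'; rewrite mxE -/j; lra.
  - move=> i ij; apply: leq_trans (card_large_eig uV' VA' ij).
    apply/subset_leq_card/subsetP => l; rewrite !inE mxE => /lt_le_trans; apply.
    have : 0 <= j%:R :> R by []. 
    rewrite -/j; lra.
have -> : \sum_l d 0 l ^+ (2 * k) = \sum_l Num.max (d 0 l) 0 ^+ (2 * k)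
    + \sum_l Num.max (- d 0 l) 0 ^+ (2 * k).
  rewrite -big_split /=; apply: eq_bigr => l _.
  have e0 : (0 : R) ^+ (2 * k) = 0 by rewrite expr0n eqn0Ngt t0.
  have [h|h] := leP (d 0 l) 0.
    by rewrite e0 add0r max_l ?oppr_ge0 // !exprM sqrrN.
  by rewrite max_r ?e0 ?addr0 // oppr_le0 ltW.
have := lerD pos neg; rewrite !sumB; lra.
Qed.

End SwapMatrix.

(** * Estimates on the levels *)

Section Analysis.
Variable R : realType.
Implicit Types (x y c g L : R) (i j t : nat).

Lemma sum_exp_coeff_le x n : 0 <= x -> \sum_(i < n) x ^+ i / i`!%:R <= expR x.
Proof.
move=> x0; rewrite -(big_mkord xpredT (fun i => x ^+ i / i`!%:R)).
apply: (@nondecreasing_cvgn_le R (series (exp_coeff x))); last exact: is_cvg_series_exp_coeff.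
apply/nondecreasing_seqP => m; rewrite /series /= big_nat_recr //= lerDl.
exact: exp_coeff_ge0.
Qed.

Lemma expn_fact_le i : i%:R ^+ i / i`!%:R <= expR i%:R :> R.
Proof.
apply: le_trans (sum_exp_coeff_le i.+1 (ler0n R i)).
by rewrite big_ord_recr /= lerDr sumr_ge0 // => m _; rewrite divr_ge0 ?exprn_ge0.
Qed.

(** The lower bound [(i / e) ^ i] on the factorial. *)
Lemma inv_fact_le i : (0 < i)%N -> i`!%:R^-1 <= expR (i%:R * (1 - ln i%:R)) :> R.
Proof.
move=> i0; have i0R : 0 < i%:R :> R by rewrite ltr0n.
rewrite mulrBr mulr1 expRB expRM_natl lnK // ler_pdivlMr ?exprn_gt0 //.
by rewrite mulrC; exact: expn_fact_le.
Qed.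

Lemma one_sub_le_exp x : 1 - x <= expR (- x).
Proof. exact: expR_ge1Dx. Qed.

(** The factorization [1 - x <= (1 - x / 2) ^ 2 * (1 - x ^ 2 / 4)] yields the
    quadratic gain over the usual [expR (- x)]. *)
Lemma one_sub_le_exp2 x : 0 <= x <= 1 -> 1 - x <= expR (- (x + x ^+ 2 / 4)).
Proof.
move=> /andP[x0 x1].
have -> : - (x + x ^+ 2 / 4) = - (x / 2) + - (x / 2) + - (x ^+ 2 / 4) by field.
rewrite 2!expRD.
apply: (@le_trans _ _ ((1 - x / 2) * (1 - x / 2) * (1 - x ^+ 2 / 4))).
  have : 0 <= x ^+ 3 * (1 - x / 4) / 4.
    by rewrite divr_ge0 // mulr_ge0 ?exprn_ge0 //; lra.
  rewrite -subr_ge0 => h; rewrite -subr_ge0; apply: le_trans h _.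
  by apply: le_of_eq; field.
have x2 : 0 <= 1 - x ^+ 2 / 4 by nra.
have x3 : 0 <= 1 - x / 2 by lra.
apply: ler_pM; rewrite ?one_sub_le_exp ?mulr_ge0 //.
by apply: ler_pM; rewrite ?one_sub_le_exp.
Qed.

(** The time [j ln j + c j] splits into a part that fights multiplicities and a
    part that, because [g] is at least the spectral gap [2 / j], produces the
    decay in [c]. *)
Lemma exp_decay b g c j t : 0 <= b -> b <= expR (- g) -> 0 < c -> (0 < j)%N ->
  2 <= g * j%:R -> j%:R * ln j%:R + c * j%:R <= t%:R ->
  b ^+ t <= expR (- (g * j%:R * ln j%:R)) * expR (- (2 * c)).
Proof.
move=> b0 bg c0 j0 g2 tj.
apply: (@le_trans _ _ (expR (- g) ^+ t)); first by rewrite lerXn2r ?nnegrE // expR_ge0.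
rewrite -expRM_natl -expRD ler_expR.
have j0R : 0 < j%:R :> R by rewrite ltr0n.
have g0 : 0 <= g by nra.
have : g * (j%:R * ln j%:R + c * j%:R) <= g * t%:R by rewrite ler_wpM2l.
nra.
Qed.

Lemma ln_le_affine L : 0 < L -> ln L <= L / 8 + 6.
Proof.
move=> L0; have L8 : 0 < L / 8 by rewrite divr_gt0.
have -> : L = L / 8 * 8 by field.
rewrite lnM ?posrE //.
have : ln (1 + (L / 8 - 1)) <= L / 8 - 1 by apply: le_ln1Dx; lra.
have : ln (1 + 7) <= 7 :> R by apply: le_ln1Dx; lra.
rewrite (_ : 1 + (L / 8 - 1) = L / 8); last by ring.
rewrite (_ : 1 + 7 = 8 :> R); last by ring.
lra.
Qed.

Lemma sqr_le_exp L : 0 <= L -> L ^+ 2 <= expR L.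
Proof.
move=> L0; have -> : expR L = (expR (L / 4) ^+ 2) ^+ 2.
  by rewrite -exprM -expRM_natl; congr expR; field.
rewrite lerXn2r ?nnegrE ?exprn_ge0 ?expR_ge0 //.
apply: (@le_trans _ _ ((1 + L / 4) ^+ 2)).
  have := sqr_ge0 (1 - L / 4); nra.
by rewrite lerXn2r ?nnegrE ?expR_ge0 ?expR_ge1Dx //; lra.
Qed.

Definition ratio j i : R := level_bound R j i / j%:R ^+ 2.

Lemma ratio_ge0 j i : (i <= j)%N -> 0 <= ratio j i.
Proof. by move=> ij; rewrite divr_ge0 ?exprn_ge0 ?level_bound_ge0. Qed.

Lemma ratio_small j i : (0 < j)%N -> (4 * i <= j)%N ->
  ratio j i = 1 - 2 * i%:R * (j%:R - i%:R + 1) / j%:R ^+ 2.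
Proof.
move=> j0 i4; rewrite /ratio /level_bound i4 /=.
by field; rewrite pnatr_eq0 -lt0n.
Qed.

Lemma ratio_le1 j i : (0 < i <= j)%N -> ratio j i <= 1 - i%:R / j%:R.
Proof.
move=> /andP[i0 ij]; have j0 : (0 < j)%N by lia.
have j0R : 0 < j%:R :> R by rewrite ltr0n.
have i0R : 0 < i%:R :> R by rewrite ltr0n.
rewrite /ratio ler_pdivrMr ?exprn_gt0 //.
have -> : (1 - i%:R / j%:R) * j%:R ^+ 2 = j%:R * (j%:R - i%:R) :> R.
  by field; rewrite pnatr_eq0 -lt0n.
rewrite /level_bound; case: ifPn => // /orP[i4|/andP[/eqP-> j1]].
  have i4R : 4 * i%:R <= j%:R :> R by rewrite -natrM ler_nat.
  nra.
have j1R : 2 <= j%:R :> R by rewrite ler_nat.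
nra.
Qed.

Lemma ratio_le2 j i : (0 < i < j)%N -> (1 < j)%N -> ratio j i <= 1 - 2 / j%:R.
Proof.
move=> /andP[i0 ij] j1; have j0 : (0 < j)%N by lia.
have j0R : 0 < j%:R :> R by rewrite ltr0n.
have [i1|i1] := leqP i 1; last first.
  apply: (le_trans (ratio_le1 _)); first by rewrite i0 ltnW.
  by rewrite lerD2l lerN2 ler_pM2r ?invr_gt0 // ler_nat.
have -> : i = 1%N by lia.
rewrite /ratio ler_pdivrMr ?exprn_gt0 //.
have -> : (1 - 2 / j%:R) * j%:R ^+ 2 = j%:R * (j%:R - 2) :> R.
  by field; rewrite pnatr_eq0 -lt0n.
rewrite /level_bound j1 orbT.
by apply: le_of_eq; ring.
Qed.

Lemma level_term_le g c j i t : (0 < i <= j)%N -> ratio j i <= expR (- g) -> 0 < c ->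
  2 <= g * j%:R -> j%:R * ln j%:R + c * j%:R <= t%:R ->
  j%:R ^+ (2 * i) / i`!%:R * ratio j i ^+ t
    <= expR (2 * i%:R * ln j%:R - g * j%:R * ln j%:R) / i`!%:R * expR (- (2 * c)).
Proof.
move=> /andP[i0 ij] rg c0 g2 tj; have j0 : (0 < j)%N by lia.
rewrite expRD -!mulrA; have -> : expR (2 * (i%:R * ln j%:R)) = j%:R ^+ (2 * i) :> R.
  by rewrite mulrA -natrM expRM_natl lnK // posrE ltr0n.
rewrite ler_wpM2l ?exprn_ge0 // [leRHS]mulrCA ler_wpM2l ?invr_ge0 //.
by have := exp_decay (ratio_ge0 ij) rg c0 j0 g2 tj; rewrite -!mulrA.
Qed.

(** With [L = ln j], the logarithm of the left-hand side without its decay in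
    [c] is at most [2 i (i - 1) L / j - ln i!] for [4 i <= j]. For [i L <= j] the
    exponent is at most [2 i], which leaves a term of an exponential series. For
    larger [i] the factorial wins and each term is below [expR (- L) = 1 / j].
    For [4 i > j] the spectral bound [1 - i / j] takes over, and its quadratic
    gain of at least [i L / 16] beats [4 i] once [L >= 80]. *)
Lemma level_term_large c j i t : (0 < i < j)%N -> 0 < c -> 80 <= ln j%:R :> R ->
  j%:R * ln j%:R + c * j%:R <= t%:R ->
  j%:R ^+ (2 * i) / i`!%:R * ratio j i ^+ t
    <= (expR 2 ^+ i / i`!%:R + j%:R^-1) * expR (- (2 * c)).
Proof.
move=> /andP[i0 ij] c0 L80 tj; set L := ln _ in L80 *.
have j0 : (0 < j)%N by lia.
have j0R : 0 < j%:R :> R by rewrite ltr0n.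
have j0N : j%:R != 0 :> R by rewrite gt_eqF.
have i1R : 1 <= i%:R :> R by rewrite ler1n.
have ijR : i%:R + 1 <= j%:R :> R by rewrite -(natrD _ i 1) ler_nat addn1.
have jE : j%:R = expR L by rewrite lnK // posrE.
have jL2 : L ^+ 2 <= j%:R by rewrite jE sqr_le_exp //; lra.
have jV : j%:R^-1 = expR (- L) by rewrite expRN -jE.
have e0 : 0 <= expR (- (2 * c)) by exact: expR_ge0.
have w0 : 0 <= expR 2 ^+ i / i`!%:R :> R by rewrite divr_ge0 ?exprn_ge0 ?expR_ge0.
have v0 : 0 <= j%:R^-1 :> R by rewrite invr_ge0.
have ile : (0 < i <= j)%N by rewrite i0 ltnW.
have factle : i`!%:R^-1 <= expR (i%:R * (1 - ln i%:R)) :> R := inv_fact_le i0.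
have [i4|i4] := leqP (4 * i) j.
  have i4R : 4 * i%:R <= j%:R :> R by rewrite -natrM ler_nat.
  pose g : R := 2 * i%:R * (j%:R - i%:R + 1) / j%:R ^+ 2.
  have rg : ratio j i <= expR (- g) by rewrite ratio_small // one_sub_le_exp.
  have gj : g * j%:R = 2 * i%:R * (j%:R - i%:R + 1) / j%:R by rewrite /g; field.
  have g2 : 2 <= g * j%:R by rewrite gj ler_pdivlMr //; nra.
  apply: le_trans (level_term_le ile rg c0 g2 tj) _; rewrite ler_wpM2r //.
  have ex : 2 * i%:R * L - g * j%:R * L = 2 * i%:R * (i%:R - 1) * L / j%:R.
    by rewrite gj; field.
  rewrite -/L ex; have [h|h] := leP (i%:R * L) j%:R.
    apply: (@le_trans _ _ (expR 2 ^+ i / i`!%:R)); last by rewrite lerDl.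
    rewrite ler_wpM2r ?invr_ge0 // -expRM_natl ler_expR ler_pdivrMr //.
    nra.
  apply: (@le_trans _ _ j%:R^-1); last by rewrite lerDr.
  apply: le_trans (ler_wpM2l (expR_ge0 _) factle) _.
  rewrite -expRD [leRHS]jV ler_expR.
  have L0 : 0 < L by lra.
  have lni : L - ln L <= ln i%:R.
    rewrite /L -ln_div ?posrE // ler_ln ?posrE ?divr_gt0 ?ltr0n //.
    by rewrite ler_pdivrMr // ltW.
  have lnL := ln_le_affine L0.
  have iL : L <= i%:R.
    rewrite -(ler_pM2r L0) -expr2; apply: le_trans jL2 _; exact: ltW.
  have b1 : 2 * i%:R * (i%:R - 1) * L / j%:R <= i%:R * (L / 2).
    rewrite ler_pdivrMr //.
    have : (4 * (i%:R - 1)) * (i%:R * L) <= j%:R * (i%:R * L).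
      by rewrite ler_wpM2r ?mulr_ge0 //; lra.
    nra.
  have : i%:R * (L / 2 + (1 - ln i%:R)) <= i%:R * (-1) by rewrite ler_wpM2l //; lra.
  lra.
have i4R : j%:R <= 4 * i%:R :> R by rewrite -natrM ler_nat ltnW.
pose g : R := i%:R / j%:R + (i%:R / j%:R) ^+ 2 / 4.
have rg : ratio j i <= expR (- g).
  apply: le_trans (ratio_le1 ile) _; apply: one_sub_le_exp2.
  by rewrite divr_ge0 //= ler_pdivrMr //; lra.
have gj : g * j%:R = i%:R + i%:R ^+ 2 / (4 * j%:R) by rewrite /g; field.
have q0 : i%:R / 16 <= i%:R ^+ 2 / (4 * j%:R) :> R.
  by rewrite ler_pdivlMr ?mulr_gt0 //; nra.
have iL : L <= i%:R by nra.
have g2 : 2 <= g * j%:R by rewrite gj; lra.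
apply: le_trans (level_term_le ile rg c0 g2 tj) _; rewrite ler_wpM2r //.
apply: (@le_trans _ _ j%:R^-1); last by rewrite lerDr.
apply: le_trans (ler_wpM2l (expR_ge0 _) factle) _.
rewrite -expRD [leRHS]jV ler_expR gj -/L.
have lni : L - 3 <= ln i%:R.
  have ln4 : ln 4 <= 3 :> R.
    have : ln (1 + 3) <= 3 :> R by apply: le_ln1Dx; lra.
    by rewrite (_ : 1 + 3 = 4 :> R) //; ring.
  have : ln (j%:R / 4) <= ln i%:R :> R.
    by rewrite ler_ln ?posrE ?divr_gt0 ?ltr0n // ler_pdivrMr // mulrC.
  rewrite ln_div ?posrE // -/L; lra.
have : i%:R * (L - L / 16 + (1 - ln i%:R)) <= i%:R * (-1) by rewrite ler_wpM2l //; lra.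
have : i%:R / 16 * L <= i%:R ^+ 2 / (4 * j%:R) * L by rewrite ler_wpM2r //; lra.
lra.
Qed.

Lemma level_term_crude c j i t : (0 < i < j)%N -> (1 < j)%N -> 0 < c ->
  j%:R * ln j%:R + c * j%:R <= t%:R ->
  j%:R ^+ (2 * i) / i`!%:R * ratio j i ^+ t
    <= expR (2 * (j%:R * ln j%:R)) * expR (- (2 * c)).
Proof.
move=> /andP[i0 ij] j1 c0 tj.
have j0R : 0 < j%:R :> R by rewrite ltr0n; lia.
have j0N : j%:R != 0 :> R by rewrite gt_eqF.
have L0 : 0 <= ln j%:R :> R by rewrite ln_ge0 // ler1n ltnW.
have rg : ratio j i <= expR (- (2 / j%:R)).
  by apply: le_trans (ratio_le2 _ j1) (one_sub_le_exp _); rewrite i0.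
have g2 : 2 <= 2 / j%:R * j%:R :> R by rewrite divfK.
have ile : (0 < i <= j)%N by rewrite i0 ltnW.
apply: le_trans (level_term_le ile rg c0 g2 tj) _.
rewrite ler_wpM2r ?expR_ge0 // ler_pdivrMr ?ltr0n ?fact_gt0 //.
apply: (@le_trans _ _ (expR (2 * (j%:R * ln j%:R)))).
  rewrite ler_expR divfK //.
  have : i%:R * ln j%:R <= j%:R * ln j%:R :> R by rewrite ler_wpM2r // ler_nat ltnW.
  lra.
by rewrite ler_peMr ?expR_ge0 // ler1n fact_gt0.
Qed.

(** When [ln j < 80] the size [j] is bounded and crude bounds on each term are
    absorbed by the constant. *)
Lemma level_sum_bound : exists b : R, 0 <= b /\
  forall c j t, 0 < c -> (1 < j)%N -> j%:R * ln j%:R + c * j%:R <= t%:R ->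
  \sum_(1 <= i < j) j%:R ^+ (2 * i) / i`!%:R * ratio j i ^+ t <= b * expR (- (2 * c)).
Proof.
pose J : R := expR 80; pose b1 := J * expR (2 * (J * 80)).
have b10 : 0 <= b1 by rewrite mulr_ge0 ?expR_ge0.
have b20 : 0 <= expR (expR 2) + 1 :> R by rewrite addr_ge0 ?expR_ge0.
exists (b1 + (expR (expR 2) + 1)); split; first exact: addr_ge0.
move=> c j t c0 j1 tj.
have j0R : 0 < j%:R :> R by rewrite ltr0n; lia.
have e0 : 0 <= expR (- (2 * c)) by exact: expR_ge0.
have [h|h] := leP 80 (ln j%:R : R).
  apply: (@le_trans _ _ ((expR (expR 2) + 1) * expR (- (2 * c)))); last first.
    by rewrite ler_wpM2r // lerDr.
  apply: (@le_trans _ _ (\sum_(1 <= i < j) (expR 2 ^+ i / i`!%:R + j%:R^-1) * expR (- (2 * c)))).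
    by apply: ler_sum_nat => i ij; apply: level_term_large.
  rewrite -mulr_suml ler_wpM2r // big_split /= lerD //.
    apply: le_trans (sum_exp_coeff_le j (expR_ge0 2)).
    rewrite -(big_mkord xpredT (fun i => expR 2 ^+ i / i`!%:R)).
    rewrite [leRHS]big_ltn ?lerDr //; last by lia.
    by rewrite divr_ge0 ?exprn_ge0 ?expR_ge0.
  rewrite sumr_const_nat -[leLHS]mulr_natl ler_pdivrMr // mul1r ler_nat; lia.
apply: (@le_trans _ _ (b1 * expR (- (2 * c)))); last by rewrite ler_wpM2r // lerDl.
have L0 : 0 <= ln j%:R :> R by rewrite ln_ge0 // ler1n ltnW.
have jJ : j%:R <= J.
  by rewrite -[leLHS]lnK ?posrE // ler_expR ltW.
apply: (@le_trans _ _ (\sum_(1 <= i < j) expR (2 * (J * 80)) * expR (- (2 * c)))).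
  apply: ler_sum_nat => i ij; apply: le_trans (level_term_crude ij j1 c0 tj) _.
  rewrite ler_wpM2r // ler_expR ler_wpM2l //.
  by apply: ler_pM => //; exact: ltW.
rewrite sumr_const_nat -[leLHS]mulr_natl mulrA ler_wpM2r // ler_wpM2r ?expR_ge0 //.
by apply: le_trans jJ; rewrite ler_nat; lia.
Qed.

End Analysis.

(** * Return probabilities *)

Lemma ffact_le_expn j i : (j ^_ i <= j ^ i)%N.
Proof.
elim: i j => [|i IH] j; first by rewrite ffactn0 expn0.
rewrite ffactnS expnS leq_mul2l; apply/orP; right; apply: leq_trans (IH _) _.
by case: (i) => // i'; rewrite leq_exp2r // leq_pred.
Qed.

Lemma level_dim_le n j i : (j <= n)%N -> (i <= j)%N ->
  (level_dim n j i * (i`! * j`!) <= n`! * j ^ (2 * i))%N.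
Proof.
move=> jn ij; rewrite /level_dim mulnACA bin_ffact.
have -> : (n`! %/ (j - i)`! * j`! = n`! * j ^_ i)%N.
  rewrite -(ffact_fact ij) [(j ^_ i * _)%N]mulnC mulnA divnK //.
  have mn : (j - i <= n)%N by lia.
  by rewrite -(bin_fact mn) mulnCA dvdn_mulr.
by rewrite mulnCA leq_mul2l mul2n -addnn expnD leq_mul ?ffact_le_expn ?orbT.
Qed.

Section TraceBound.
Variable R : realType.

Lemma level_dim_leR n j i : (j <= n)%N -> (i <= j)%N ->
  (level_dim n j i)%:R <= n`!%:R / j`!%:R * (j%:R ^+ (2 * i) / i`!%:R) :> R.
Proof.
move=> jn ij; have f0 m : 0 < m`!%:R :> R by rewrite ltr0n fact_gt0.
rewrite mulrACA -invfM ler_pdivlMr ?mulr_gt0 //.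
by rewrite -natrX -!natrM ler_nat [(j`! * _)%N]mulnC level_dim_le.
Qed.

(** The top eigenvalue [j ^ 2], of multiplicity at most [n! / j!], contributes
    the term [1]; everything else decays. *)
Lemma trace_bound : exists b : R, 0 <= b /\
  forall (T : finType) (C : {set T}) (c : R) (k : nat),
  0 < c -> (0 < k)%N -> (0 < #|C|)%N ->
  #|C|%:R * ln #|C|%:R + c * #|C|%:R <= (2 * k)%:R ->
  \tr (swap_mx R C ^+ (2 * k)) <=
    #|T|`!%:R / #|C|`!%:R * #|C|%:R ^+ (4 * k) * (1 + b * expR (- (2 * c))).
Proof.
have [b [b0 Sb]] := level_sum_bound R.
exists (1 + 2 * b); split; first by rewrite addr_ge0 ?mulr_ge0.
move=> T C c k c0 k0 C0 kC.
apply: le_trans (trace_swap_bound R k0 C0) _.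
move: kC C0; set t := (2 * k)%N; set j := #|C|; set n := #|T| => kC j0.
have jn : (j <= n)%N by exact: max_card.
have j0R : 0 < j%:R :> R by rewrite ltr0n.
have j0N : j%:R != 0 :> R by rewrite gt_eqF.
set w : R := n`!%:R / j`!%:R; set M : R := j%:R ^+ (4 * k).
have w0 : 0 <= w by rewrite divr_ge0.
have M0 : 0 <= M by rewrite exprn_ge0.
have Mt : M = (j%:R ^+ 2) ^+ t by rewrite -exprM; congr (_ ^+ _); rewrite /t; lia.
set e := expR (- (2 * c)); have e0 : 0 <= e by exact: expR_ge0.
have D0 : (level_dim n j 0)%:R <= w.
  by apply: le_trans (level_dim_leR jn (leq0n j)) _; rewrite muln0 expr0 fact0 divr1 mulr1.
have -> : (j ^ 2)%:R ^+ t = M by rewrite natrX Mt.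
have mx : Num.max ((j ^ 2)%:R - 2 * j%:R) 0 ^+ t <= M * e.
  have [j1|j1] := leqP j 1.
    have -> : j = 1%N by lia.
    rewrite max_r; last by rewrite mulr1; lra.
    by rewrite expr0n gtn_eqF ?mulr_ge0 // muln_gt0.
  have j2R : 2 <= j%:R :> R by rewrite ler_nat.
  have r0 : 0 <= 1 - 2 / j%:R :> R by rewrite subr_ge0 ler_pdivrMr // mul1r.
  have -> : (j ^ 2)%:R - 2 * j%:R = j%:R ^+ 2 * (1 - 2 / j%:R) :> R by rewrite natrX; field.
  rewrite max_l ?mulr_ge0 ?exprn_ge0 // exprMn -Mt ler_wpM2l //.
  have g2 : 2 <= 2 / j%:R * j%:R :> R by rewrite divfK.
  apply: le_trans (exp_decay r0 (one_sub_le_exp _) c0 j0 g2 kC) _.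
  rewrite -[leRHS]mul1r ler_wpM2r // expR_le1 oppr_le0 divfK // mulr_ge0 //.
  by rewrite ln_ge0 // ler1n.
have S : \sum_(1 <= i < j) (level_dim n j i)%:R * level_bound R j i ^+ t <= w * M * (b * e).
  have [j1|j1] := leqP j 1.
    by rewrite big_geq // mulr_ge0 // mulr_ge0.
  apply: (@le_trans _ _ (w * M * \sum_(1 <= i < j) j%:R ^+ (2 * i) / i`!%:R * ratio R j i ^+ t)).
    rewrite mulr_sumr; apply: ler_sum_nat => i /andP[i0 ij].
    have -> : level_bound R j i = j%:R ^+ 2 * ratio R j i.
      by rewrite /ratio; field.
    rewrite exprMn -Mt; have := level_dim_leR jn (ltnW ij).
    move=> /(ler_wpM2r (_ : 0 <= M * ratio R j i ^+ t)) h.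
    apply: le_trans (h _) _; first by rewrite mulr_ge0 ?exprn_ge0 ?ratio_ge0 // ltnW.
    by apply: le_of_eq; rewrite -/w; ring.
  by apply: ler_wpM2l; [exact: mulr_ge0 | exact: Sb].
have : (level_dim n j 0)%:R * (M + Num.max ((j ^ 2)%:R - 2 * j%:R) 0 ^+ t) <= w * (M + M * e).
  apply: ler_pM => //; last by rewrite lerD2l.
  by rewrite addr_ge0 // exprn_ge0 // le_max lexx orbT.
move=> h; apply: le_trans (lerD h (ler_wpM2l _ S)) _ => //.
by apply: le_of_eq; ring.
Qed.

End TraceBound.

Section Walk.
Variables (R : rcfType) (T : finType) (C : {set T}).

(** The number of words of [k] pairs of points of [C] whose transpositions
    multiply to [s]. *)
Fixpoint walk k : {perm T} -> R :=
  if k is k'.+1 then swap_sum C (walk k') else fun s => (s == 1%g)%:R.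

Lemma exp_swap_mxE k (i j : 'I_#|{: {perm T}}|) :
  (swap_mx R C ^+ k) i j = walk k ((enum_val i)^-1 * enum_val j)%g.
Proof.
elim: k j => [|k IH] j.
  by rewrite expr0 mxE /= -eq_mulVg1 (inj_eq enum_val_inj).
have := row_fun_swap C (row i (swap_mx R C ^+ k)) (enum_val j).
rewrite -row_mul /row_fun mxE enum_valK exprSr => -> /=.
apply: eq_bigr => a _; apply: eq_bigr => b _.
by rewrite mxE IH enum_rankK mulgA.
Qed.

Lemma trmx_exp_swap k : (swap_mx R C ^+ k)^T = swap_mx R C ^+ k.
Proof.
elim: k => [|k IH]; first by rewrite expr0 trmx1.
by rewrite exprS -mulmxE trmx_mul IH swap_mx_sym mulmxE -exprSr exprS.
Qed.

(** All diagonal entries of the power agree by left translation, and each is a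
    squared norm because the operator is symmetric. *)
Lemma trace_walk k : \tr (swap_mx R C ^+ (2 * k)) = #|T|`!%:R * \sum_s walk k s ^+ 2.
Proof.
have -> : #|T|`! = #|{: {perm T}}|.
  transitivity #|Sym [set: T]|; first by rewrite card_Sym cardsT.
  by apply: eq_card => p; rewrite !inE; apply/subsetP => x; rewrite inE.
rewrite mul2n -addnn exprD /mxtrace mulr_natl -[in RHS](card_ord #|_|) -sumr_const.
apply: eq_bigr => i _; rewrite -mulmxE mxE.
rewrite (reindex _ (onW_bij _ (@enum_rank_bij {perm T}))) /=.
rewrite [RHS](reindex_inj (mulgI (enum_val i)^-1)%g) /=.
apply: eq_bigr => s _.
have -> : (swap_mx R C ^+ k) (enum_rank s) i = (swap_mx R C ^+ k) i (enum_rank s).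
  by rewrite -[in LHS]trmx_exp_swap mxE.
by rewrite exp_swap_mxE enum_rankK expr2.
Qed.

Lemma sum_walk k : \sum_s walk k s = #|C|%:R ^+ (2 * k).
Proof.
elim: k => [|k IH].
  rewrite muln0 expr0 (bigD1 1%g) //= eqxx big1 ?addr0 // => s /negPf -> //.
rewrite /= /swap_sum exchange_big /=; under eq_bigr do rewrite exchange_big /=.
under eq_bigr do under eq_bigr do rewrite sumr_shift IH.
rewrite !sumr_const_card mulnS exprD; ring.
Qed.

End Walk.

(** * Random transpositions as augmented permutations *)

Lemma tperm_eq (T : finType) (a b i j : T) : i != j -> a != b ->
  (tperm a b == tperm i j) = (a == i) && (b == j) || (a == j) && (b == i).
Proof.
move=> ij ab; apply/eqP/orP => [e|[|] /andP[/eqP-> /eqP->] //]; last exact: tpermC.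
have : tperm i j a = b by rewrite -e tpermL.
case: tpermP => [-> <-|-> <-|_ _ e']; rewrite ?eqxx; [by left|by right|].
by rewrite e' eqxx in ab.
Qed.

Section RandomTranspositions.
Variables (R : realType) (n : nat).

Lemma aug_proof (a b : 'I_n) :
  (if a == b then [set a] else set0) \subset fixed_points (tperm a b).
Proof.
case: eqP => [->|_]; last exact: sub0set.
by apply/subsetP => x; rewrite !inE tperm1 perm1.
Qed.

Definition aug (a b : 'I_n) : aug_perm n :=
  Sub (tperm a b, if a == b then [set a] else set0) (aug_proof a b).

Lemma aug_eqE a b (rho : aug_perm n) :
  (aug a b == rho) = ((tperm a b, if a == b then [set a] else set0) == val rho).
Proof. by rewrite -(inj_eq val_inj). Qed.

Lemma augI_aug a b : augI (aug a b) = [set a; b].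
Proof.
apply/setP => x; rewrite /augI /augT SubK !inE /=.
have [->|ab] := eqVneq a b; first by rewrite tperm1 perm1 eqxx inE orbb.
rewrite inE orbF; case: tpermP => [->|->|/eqP xa /eqP xb].
- by rewrite eqxx eq_sym ab.
- by rewrite eqxx orbT ab.
- by rewrite eqxx (negPf xa) (negPf xb).
Qed.

Lemma sum_pair_indicator (i j : 'I_n) :
  \sum_a \sum_b ((a == i) && (b == j))%:R = 1 :> R.
Proof.
rewrite (bigD1 i) //= (bigD1 j) //= !eqxx big1 ?addr0 => [|b /negPf-> //].
by rewrite big1 ?addr0 // => a /negPf ai; rewrite big1 // => b _; rewrite ai.
Qed.

(** The measure is the law of [aug a b] for uniform independent [a] and [b]. *)
Lemma QhatE (rho : aug_perm n) :
  Qhat R rho = n%:R ^- 2 * \sum_a \sum_b (aug a b == rho)%:R.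
Proof.
rewrite /Qhat; case: ifPn => [/existsP[j /eqP ej]|H1].
  transitivity (n%:R ^- 2 * \sum_a \sum_b ((a == j) && (b == j))%:R : R).
    by rewrite sum_pair_indicator mulr1 div1r.
  congr (_ * _).
  apply: eq_bigr => a _; apply: eq_bigr => b _; apply: (congr1 (fun x : bool => x%:R)).
  rewrite aug_eqE ej xpair_eqE.
  have [<-|ab] := eqVneq a b; rewrite ?tperm1 ?eqxx /=.
    rewrite andbb; apply/eqP/eqP => [->//|/setP/(_ a)].
    by rewrite !inE eqxx => /esym/eqP.
  have -> : (set0 == [set j]) = false.
    by apply/eqP => /setP/(_ j); rewrite !inE eqxx.
  rewrite andbF; apply/andP => -[/eqP aj /eqP bj].
  by rewrite aj bj eqxx in ab.
case: ifPn => [/existsP[i /existsP[j /andP[ij /eqP e]]]|H2].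
  transitivity (n%:R ^- 2 * (\sum_a \sum_b ((a == i) && (b == j))%:R
      + \sum_a \sum_b ((a == j) && (b == i))%:R) : R).
    by rewrite !sum_pair_indicator mulrC; congr (_ * _); ring.
  congr (_ * _); rewrite -big_split /=; apply: eq_bigr => a _.
  rewrite -big_split /=; apply: eq_bigr => b _.
  rewrite aug_eqE e xpair_eqE.
  have [<-|ab] := eqVneq a b.
    have -> : ([set a] == set0) = false.
      by apply/eqP => /setP/(_ a); rewrite !inE eqxx.
    rewrite andbF; have [->|ai] := eqVneq a i; rewrite ?(negPf ij) /= ?andbF ?addr0 //.
  rewrite eqxx andbT tperm_eq //.
  have [->|ai] /= := eqVneq a i; last by rewrite add0r.
  by rewrite (negPf ij) /= orbF addr0.
rewrite big1 ?mulr0 // => a _; rewrite big1 // => b _.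
case: eqP => // e; case/negP: H1; move: H2; rewrite -e.
have [<-|ab] := eqVneq a b.
  by move=> _; apply/existsP; exists a; rewrite /aug SubK /= eqxx tperm1.
case/negP; apply/existsP; exists a; apply/existsP; exists b.
by rewrite ab /= (negPf ab).
Qed.

Lemma Qhat_sum (F : aug_perm n -> R) :
  \sum_rho Qhat R rho * F rho = n%:R ^- 2 * \sum_a \sum_b F (aug a b).
Proof.
transitivity (n%:R ^- 2 * \sum_rho \sum_a \sum_b (aug a b == rho)%:R * F rho).
  rewrite mulr_sumr; apply: eq_bigr => rho _; rewrite QhatE -mulrA; congr (_ * _).
  by rewrite mulr_suml; apply: eq_bigr => a _; rewrite mulr_suml.
congr (_ * _); rewrite exchange_big /=; apply: eq_bigr => a _.
rewrite exchange_big /=; apply: eq_bigr => b _.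
rewrite (bigD1 (aug a b)) //= eqxx mul1r big1 ?addr0 // => rho.
by rewrite eq_sym => /negPf->; rewrite mul0r.
Qed.

End RandomTranspositions.

Section Iterates.
Variables (R : realType) (T : finType) (K : T -> T -> R).

Lemma kernel_iter0 s t : kernel_iter K 0 s t = (s == t)%:R.
Proof. by rewrite /kernel_iter expr0 mxE (inj_eq enum_rank_inj). Qed.

Lemma kernel_iterS k s t : kernel_iter K k.+1 s t = \sum_u kernel_iter K k s u * K u t.
Proof.
rewrite /kernel_iter exprSr -mulmxE mxE.
rewrite (reindex _ (onW_bij _ (@enum_rank_bij T))) /=.
by apply: eq_bigr => u _; rewrite mxE !enum_rankK.
Qed.

(** The total variation is half the l1 norm since the two masses agree, and the
    l1 norm is at most the l2 norm by the Cauchy-Schwarz inequality in the form of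
    the nonnegative variance of [`|nu| / p]. *)
Lemma tv_le_l2 (nu1 nu2 p : T -> R) :
  (forall t, 0 < p t) -> \sum_t p t = 1 -> \sum_t nu1 t = \sum_t nu2 t ->
  tv_dist nu1 nu2 <= 1 / 2 * l2_norm p (fun t => nu1 t - nu2 t).
Proof.
move=> p0 p1 nue; pose nu t := nu1 t - nu2 t; pose M := \sum_t `|nu t|.
have M0 : 0 <= M by apply: sumr_ge0.
have ML : M <= l2_norm p nu.
  rewrite /l2_norm -(ger0_norm M0) -sqrtr_sqr ler_wsqrtr //.
  have : 0 <= \sum_t p t * (`|nu t| / p t - M) ^+ 2.
    by apply: sumr_ge0 => t _; rewrite mulr_ge0 ?sqr_ge0 // ltW.
  have -> : \sum_t p t * (`|nu t| / p t - M) ^+ 2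
     = \sum_t (nu t ^+ 2 / p t - 2 * M * `|nu t| + M ^+ 2 * p t).
    apply: eq_bigr => t _; rewrite -(real_normK (num_real (nu t))).
    by field; rewrite gt_eqF.
  by rewrite big_split sumrB -!mulr_sumr p1 /= -/M; nra.
rewrite /tv_dist; apply: (big_ind (fun x => x <= 1 / 2 * l2_norm p nu)).
- by apply: mulr_ge0; [lra | exact: sqrtr_ge0].
- by move=> x y xl yl; rewrite ge_max xl yl.
move=> A _.
have -> : mass nu1 A - mass nu2 A = \sum_(t in A) nu t by rewrite /mass -sumrB.
have s0 : \sum_(t in A) nu t + \sum_(t in ~: A) nu t = 0.
  transitivity (\sum_t nu t); last by rewrite sumrB nue subrr.
  rewrite [RHS](bigID (mem A)) /=; congr (_ + _); apply: eq_bigl => t.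
  by rewrite inE.
have sM : M = \sum_(t in A) `|nu t| + \sum_(t in ~: A) `|nu t|.
  rewrite /M [LHS](bigID (mem A)) /=; congr (_ + _); apply: eq_bigl => t.
  by rewrite inE.
have h1 : `|\sum_(t in A) nu t| <= \sum_(t in A) `|nu t| by exact: ler_norm_sum.
have h2 : `|\sum_(t in ~: A) nu t| <= \sum_(t in ~: A) `|nu t| by exact: ler_norm_sum.
have h3 : `|\sum_(t in ~: A) nu t| = `|\sum_(t in A) nu t|.
  by rewrite -normrN; congr (`|_|); lra.
have : `|\sum_(t in A) nu t| <= 1 / 2 * M by lra.
move=> /le_trans; apply; lra.
Qed.

End Iterates.

(** * The density of the chain *)

Section Density.
Variables (R : realType) (n : nat) (G : finGroupType) (P : G -> R) (x0 : {ffun 'I_n -> G}).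
Hypotheses (P0 : forall g, 0 < P g) (P1 : \sum_g P g = 1).
Implicit Types (B I : {set 'I_n}) (x y : {ffun 'I_n -> G}) (s : 'S_n) (k : nat).

(** The density of the Dirac mass at [x0 l] with respect to [P], minus its mean. *)
Definition dev (l : 'I_n) (g : G) : R := (g == x0 l)%:R / P g - 1.

Definition dev_prod B x := \prod_(l in B) dev l (x l).

Lemma prod_set_mkcond B (F : 'I_n -> R) :
  \prod_(l in B) F l = \prod_l (if l \in B then F l else 1).
Proof. exact: big_mkcond. Qed.

Let PN0 g : P g != 0. Proof. by rewrite gt_eqF. Qed.

Lemma mean_dev l : \sum_g P g * dev l g = 0.
Proof.
transitivity (\sum_g ((g == x0 l)%:R - P g)).
  by apply: eq_bigr => g _; rewrite /dev; field.
rewrite sumrB P1 (bigD1 (x0 l)) //= eqxx big1 ?addr0 ?subrr // => g /negPf->//.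
Qed.

Lemma var_dev l : \sum_g P g * dev l g ^+ 2 = 1 / P (x0 l) - 1.
Proof.
transitivity (\sum_g ((g == x0 l)%:R * (1 / P (x0 l)) - 2 * (g == x0 l)%:R + P g)).
  apply: eq_bigr => g _; by rewrite /dev; case: eqP => [->|_] /=; field; rewrite ?PN0.
rewrite big_split sumrB /= -mulr_suml -mulr_sumr P1.
have -> : \sum_g (g == x0 l)%:R = 1 :> R.
  by rewrite (bigD1 (x0 l)) //= eqxx big1 ?addr0 // => g /negPf->.
ring.
Qed.

Lemma sum_prod_ffun (F : 'I_n -> G -> R) :
  \sum_(x : {ffun 'I_n -> G}) \prod_i F i (x i) = \prod_i \sum_g F i g.
Proof. by rewrite bigA_distr_bigA. Qed.

Lemma dev_prod_orth B B' :
  \sum_(x : {ffun 'I_n -> G}) \prod_i P (x i) * (dev_prod B x * dev_prod B' x)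
    = if B == B' then \prod_(l in B) (1 / P (x0 l) - 1) else 0.
Proof.
pose F i g := P g * ((if i \in B then dev i g else 1) * (if i \in B' then dev i g else 1)).
transitivity (\sum_(x : {ffun 'I_n -> G}) \prod_i F i (x i)).
  by apply: eq_bigr => x _; rewrite /dev_prod !prod_set_mkcond -!big_split.
rewrite sum_prod_ffun; have [eB|BB'] := eqVneq B B'.
  rewrite prod_set_mkcond; apply: eq_bigr => i _; rewrite /F -eB; case: ifP => _.
    by rewrite -var_dev; apply: eq_bigr => g _; rewrite expr2.
  by rewrite -[RHS]P1; apply: eq_bigr => g _; rewrite !mulr1.
have [i Bi] : exists i, (i \in B) != (i \in B').
  apply/existsP; apply: contraNT BB'; rewrite negb_exists => /forallP H.
  by apply/eqP/setP => i; apply/eqP; rewrite -[_ == _]negbK H.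
rewrite (bigD1 i) //= -[X in X * _ = _](_ : 0 = _) ?mul0r //.
rewrite -[LHS](mean_dev i); apply: eq_bigr => g _; rewrite /F.
by move: Bi; case: (i \in B); case: (i \in B') => // _; rewrite ?mulr1 ?mul1r.
Qed.

(** Resampling a coordinate replaces a function of it by its mean, and the
    deviations have mean [0]: a product of deviations survives one step exactly
    when no index of [B] is resampled. *)
Lemma dev_prod_resample B I x :
  \sum_(y : {ffun 'I_n -> G}) \prod_i P (y i) * dev_prod B y
    * \prod_(l | l \notin I) (y l == x l)%:R * \prod_(j in I) P (x j)
  = if I \subset ~: B then \prod_i P (x i) * dev_prod B x else 0.
Proof.
pose F i g := P g * (if i \in B then dev i g else 1) * (if i \in I then 1 else (g == x i)%:R).
transitivity (\prod_i ((\sum_g F i g) * (if i \in I then P (x i) else 1))).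
  rewrite big_split /= -sum_prod_ffun mulr_suml; apply: eq_bigr => y _.
  rewrite -prod_set_mkcond; congr (_ * _); rewrite /F !big_split /= /dev_prod prod_set_mkcond.
  congr (_ * _); rewrite big_mkcond; apply: eq_bigr => i _.
  by case: (i \in I).
case: ifPn => [/subsetP sI|/subsetPn[i iI iB]].
  rewrite /dev_prod prod_set_mkcond -big_split /=; apply: eq_bigr => i _; rewrite /F.
  case: ifP => iI.
    have iB : (i \in B) = false by apply/negbTE; rewrite -in_setC sI.
    rewrite iB mulr1; under eq_bigr do rewrite !mulr1.
    by rewrite P1 mul1r.
  rewrite mulr1 (bigD1 (x i)) //= eqxx mulr1 big1 ?addr0 // => g /negPf->.
  by rewrite mulr0.
rewrite (bigD1 i) //=; suff -> : \sum_g F i g = 0 by rewrite !mul0r.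
rewrite -[RHS](mean_dev i); apply: eq_bigr => g _; rewrite /F iI mulr1.
by move: iB; rewrite inE negbK => ->.
Qed.

(** The probability that after [k] steps the permutation is [s] and no index of
    [B] was ever resampled: such steps are the pairs of points outside [B]. *)
Definition alive_mass k B s : R := (n%:R ^- 2) ^+ k * walk R (~: B) k s.

Lemma alive_massS k B s : alive_mass k.+1 B s =
  n%:R ^- 2 * \sum_a \sum_b (if [set a; b] \subset ~: B
                             then alive_mass k B (s * tperm a b)%g else 0).
Proof.
rewrite /alive_mass exprS -mulrA; congr (_ * _).
rewrite /= /swap_sum mulr_sumr big_mkcond; apply: eq_bigr => a _.
rewrite mulr_sumr; case: ifP => [aB|/negbT aB].
  rewrite big_mkcond; apply: eq_bigr => b _.
  by rewrite subUset !sub1set aB /=; case: ifP.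
by rewrite big1 // => b _; rewrite subUset !sub1set (negPf aB).
Qed.

Lemma transition_aug (v w : state n G) : transition P (@Qhat n R) v w =
  n%:R ^- 2 * \sum_a \sum_b ((v.2 == w.2 * tperm a b)%g%:R
     * (\prod_(j in [set a; b]) P (w.1 j)
        * \prod_(l | l \notin [set a; b]) (v.1 l == w.1 l)%:R)).
Proof.
rewrite /transition big_mkcond /=.
transitivity (\sum_rho Qhat R rho * ((augT rho == (v.2^-1 * w.2)%g)%:R *
   (\prod_(j in augI rho) P (w.1 j) * \prod_(l | l \notin augI rho) (v.1 l == w.1 l)%:R))).
  by apply: eq_bigr => rho _; case: ifP; rewrite ?mul0r ?mulr0 // mul1r mulrA.
rewrite Qhat_sum; congr (_ * _); apply: eq_bigr => a _; apply: eq_bigr => b _.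
rewrite augI_aug; congr (_ * _); apply: (congr1 (fun x : bool => x%:R)).
rewrite /augT SubK /=; apply/eqP/eqP => [e|->].
  by rewrite -[w.2](mulKVg v.2) -e -mulgA tperm2 mulg1.
by rewrite invMg tpermV -mulgA mulVg mulg1.
Qed.

Lemma sum_transition (Phi : 'S_n -> R) y x s :
  \sum_p Phi p * transition P (@Qhat n R) (y, p) (x, s) =
  n%:R ^- 2 * \sum_a \sum_b Phi (s * tperm a b)%g *
    (\prod_(j in [set a; b]) P (x j) * \prod_(l | l \notin [set a; b]) (y l == x l)%:R).
Proof.
under eq_bigr do rewrite transition_aug mulrCA mulr_sumr.
rewrite -mulr_sumr; congr (_ * _); rewrite exchange_big; apply: eq_bigr => a _ /=.
under eq_bigr do rewrite mulr_sumr.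
rewrite exchange_big; apply: eq_bigr => b _ /=.
rewrite (bigD1 (s * tperm a b)%g) //= eqxx mul1r [X in _ + X]big1 ?addr0 // => p /negPf->.
by rewrite mul0r mulr0.
Qed.

(** At time [0] this is the expansion of
    [\prod_i [x i = x0 i] = \prod_i P (x i) * (dev i (x i) + 1)]; each
    step acts on the coefficients by [alive_massS]. *)
Lemma density k x s :
  kernel_iter (transition P (@Qhat n R)) k (x0, 1%g) (x, s)
  = \prod_i P (x i) * \sum_B alive_mass k B s * dev_prod B x.
Proof.
elim: k x s => [|k IH] x s.
  rewrite kernel_iter0 /alive_mass expr0 /=.
  under [X in _ * X]eq_bigr do rewrite mul1r.
  rewrite -mulr_sumr xpair_eqE eq_sym [(1%g == s)]eq_sym.
  have -> : \sum_B dev_prod B x = \prod_i (dev i (x i) + 1).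
    rewrite bigA_distr; apply: eq_bigr => B _.
    by rewrite /dev_prod prod_set_mkcond.
  rewrite mulrCA -big_split /=.
  under eq_bigr => i _ do rewrite /dev subrK mulrC divfK ?PN0 //.
  have -> : \prod_i (x i == x0 i)%:R = (x == x0)%:R :> R.
    have [->|nx] := eqVneq x x0; first by rewrite big1 // => i _; rewrite eqxx.
    have [i xi] : exists i, x i != x0 i.
      apply/existsP; apply: contraNT nx; rewrite negb_exists => /forallP H.
      by apply/eqP/ffunP => i; apply/eqP; rewrite -[_ == _]negbK H.
    by rewrite (bigD1 i) //= (negPf xi) mul0r.
  by rewrite -natrM mulnb andbC.
rewrite kernel_iterS.
transitivity (\sum_(y : {ffun 'I_n -> G}) \sum_(p : 'S_n)
    (\prod_i P (y i) * \sum_B alive_mass k B p * dev_prod B y)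
    * transition P (@Qhat n R) (y, p) (x, s)).
  by rewrite pair_big /=; apply: eq_bigr => -[y p] _; rewrite IH.
transitivity (n%:R ^- 2 * \sum_a \sum_b \sum_B alive_mass k B (s * tperm a b)%g *
   (if [set a; b] \subset ~: B then \prod_i P (x i) * dev_prod B x else 0)).
  transitivity (\sum_(y : {ffun 'I_n -> G}) n%:R ^- 2 * \sum_a \sum_b \sum_B
     alive_mass k B (s * tperm a b)%g *
     (\prod_i P (y i) * dev_prod B y
    * \prod_(l | l \notin [set a; b]) (y l == x l)%:R * \prod_(j in [set a; b]) P (x j))).
    apply: eq_bigr => y _.
    rewrite (sum_transition (fun p => \prod_i P (y i) * \sum_B alive_mass k B p * dev_prod B y)).
    congr (_ * _); apply: eq_bigr => a _; apply: eq_bigr => b _.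
    rewrite -mulrA mulrCA mulr_suml; apply: eq_bigr => B _; ring.
  rewrite -mulr_sumr; congr (_ * _); rewrite exchange_big; apply: eq_bigr => a _ /=.
  rewrite exchange_big; apply: eq_bigr => b _ /=.
  rewrite exchange_big; apply: eq_bigr => B _ /=.
  by rewrite -mulr_sumr dev_prod_resample.
transitivity (\sum_B n%:R ^- 2 * \sum_a \sum_b alive_mass k B (s * tperm a b)%g *
   (if [set a; b] \subset ~: B then \prod_i P (x i) * dev_prod B x else 0)).
  rewrite -mulr_sumr; congr (_ * _); rewrite [RHS]exchange_big /=.
  by apply: eq_bigr => a _; rewrite [RHS]exchange_big.
rewrite [RHS]mulr_sumr; apply: eq_bigr => B _.
rewrite alive_massS -mulrA [RHS]mulrCA; congr (_ * _).
rewrite [in RHS]mulr_suml [RHS]mulr_sumr; apply: eq_bigr => a _.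
rewrite [in RHS]mulr_suml [RHS]mulr_sumr; apply: eq_bigr => b _.
case: ifP => _; ring.
Qed.

End Density.

(** * Distances to stationarity *)

Section Distance.
Variables (R : realType) (n : nat) (G : finGroupType) (P : G -> R) (x0 : {ffun 'I_n -> G}).
Hypotheses (P0 : forall g, 0 < P g) (P1 : \sum_g P g = 1).
Implicit Types (B : {set 'I_n}) (x : {ffun 'I_n -> G}) (s : 'S_n) (k : nat).

Definition mass_error k B s : R := alive_mass R k B s - (B == set0)%:R / n`!%:R.

Let law k := kernel_iter (transition P (@Qhat n R)) k (x0, 1%g).
Let limit := @stationary R n G P.

Lemma stationary_gt0 w : 0 < limit w.
Proof. by rewrite mulr_gt0 ?invr_gt0 ?ltr0n ?fact_gt0 // prodr_gt0. Qed.

Lemma sum_perm_const (c : R) : \sum_(s : 'S_n) c = n`!%:R * c.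
Proof. by rewrite sumr_const card_Sn mulr_natl. Qed.

Lemma sum_state (F : state n G -> R) : \sum_w F w = \sum_s \sum_x F (x, s).
Proof. by rewrite exchange_big pair_big; apply: eq_bigr => -[]. Qed.

Lemma sum_weight : \sum_(x : {ffun 'I_n -> G}) \prod_i P (x i) = 1.
Proof. by rewrite (sum_prod_ffun (fun=> P)) big1. Qed.

Lemma sum_stationary : \sum_w limit w = 1.
Proof.
rewrite sum_state /limit /stationary /=; under eq_bigr do rewrite -mulr_sumr sum_weight mulr1.
by rewrite sum_perm_const divff // pnatr_eq0 -lt0n fact_gt0.
Qed.

(** The stationary density is the constant coefficient alone, at [B = set0]. *)
Lemma law_error k x s :
  law k (x, s) - limit (x, s) = \prod_i P (x i) * \sum_B mass_error k B s * dev_prod P x0 B x.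
Proof.
rewrite /law density // /limit /stationary /= [n`!%:R^-1 * _]mulrC -mulrBr; congr (_ * _).
rewrite -[X in _ - X]mul1r.
have -> : 1 * n`!%:R^-1 = \sum_B ((B == set0)%:R / n`!%:R) * dev_prod P x0 B x :> R.
  rewrite (bigD1 set0) //= eqxx /dev_prod big_set0 mulr1 big1 ?addr0 // => B /negPf->.
  by rewrite !mul0r.
by rewrite -sumrB; apply: eq_bigr => B _; rewrite -mulrBl.
Qed.

Lemma sum_law_error k : \sum_w (law k w - limit w) = \sum_(s : 'S_n) mass_error k set0 s.
Proof.
rewrite sum_state /=; apply: eq_bigr => s _; under eq_bigr do rewrite law_error mulr_sumr.
rewrite exchange_big /= (bigD1 set0) //= [X in _ + X]big1 ?addr0 => [|B /negPf B0].
  under eq_bigr do rewrite /dev_prod big_set0 mulr1 mulrC.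
  by rewrite -mulr_sumr sum_weight mulr1.
have := dev_prod_orth x0 P0 P1 B set0; rewrite B0 => e.
transitivity (mass_error k B s * \sum_(x : {ffun 'I_n -> G})
   \prod_i P (x i) * (dev_prod P x0 B x * dev_prod P x0 set0 x)); last by rewrite e mulr0.
rewrite mulr_sumr; apply: eq_bigr => x _; rewrite [dev_prod P x0 set0 x]big_set0 mulr1.
by rewrite mulrCA.
Qed.

(** Parseval, as the products of deviations are orthogonal. *)
Lemma law_error_l2 k : \sum_w (law k w - limit w) ^+ 2 / limit w
  = \sum_B (n`!%:R * \sum_s mass_error k B s ^+ 2) * \prod_(l in B) (1 / P (x0 l) - 1).
Proof.
rewrite sum_state.
transitivity (\sum_s n`!%:R * \sum_B mass_error k B s ^+ 2 * \prod_(l in B) (1 / P (x0 l) - 1)).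
  apply: eq_bigr => s _.
  transitivity (n`!%:R * \sum_(x : {ffun 'I_n -> G}) \sum_B \sum_B'
      mass_error k B s * mass_error k B' s *
      (\prod_i P (x i) * (dev_prod P x0 B x * dev_prod P x0 B' x))).
    rewrite mulr_sumr; apply: eq_bigr => x _; rewrite law_error.
    set w := \prod_i P (x i); have w0 : w != 0 by rewrite gt_eqF // prodr_gt0.
    have f0 : n`!%:R != 0 :> R by rewrite pnatr_eq0 -lt0n fact_gt0.
    transitivity (n`!%:R * (w * ((\sum_B mass_error k B s * dev_prod P x0 B x) *
                             (\sum_B mass_error k B s * dev_prod P x0 B x)))).
      by rewrite /limit /stationary /= -/w; field; rewrite ?w0 ?f0.
    congr (_ * _); rewrite mulr_suml mulr_sumr; apply: eq_bigr => B _.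
    by rewrite mulr_sumr mulr_sumr; apply: eq_bigr => B' _; ring.
  congr (_ * _); rewrite exchange_big; apply: eq_bigr => B _ /=.
  rewrite exchange_big /= (bigD1 B) //= [X in _ + X]big1 ?addr0 => [|B' /negPf B'B].
    by rewrite -mulr_sumr dev_prod_orth // eqxx expr2.
  by rewrite -mulr_sumr dev_prod_orth // eq_sym B'B mulr0.
rewrite -mulr_sumr exchange_big /= mulr_sumr; apply: eq_bigr => B _.
by rewrite -mulr_suml mulrA.
Qed.

Lemma alive_mass_energy k B : (0 < n)%N ->
  n`!%:R * \sum_(s : 'S_n) alive_mass R k B s ^+ 2
    = \tr (swap_mx R (~: B) ^+ (2 * k)) / n%:R ^+ (4 * k).
Proof.
move=> n0; rewrite trace_walk card_ord -mulrA; congr (_ * _); rewrite mulr_suml.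
apply: eq_bigr => s _; rewrite /alive_mass exprMn mulrC; congr (_ * _).
by rewrite -exprM exprVn -exprM; congr (_ ^-1); congr (_ ^+ _); lia.
Qed.

Lemma sum_alive_mass k : (0 < n)%N -> \sum_(s : 'S_n) alive_mass R k set0 s = 1.
Proof.
move=> n0; rewrite -mulr_sumr setC0 sum_walk cardsT card_ord exprVn -exprM.
by rewrite mulVf // expf_neq0 // pnatr_eq0 -lt0n.
Qed.

Lemma sum_mass_error0 k : (0 < n)%N -> \sum_(s : 'S_n) mass_error k set0 s = 0.
Proof.
move=> n0; rewrite sumrB sum_alive_mass // eqxx sum_perm_const mul1r divff ?subrr //.
by rewrite pnatr_eq0 -lt0n fact_gt0.
Qed.

(** The variance identity: the masses add up to [1] and their mean is [1 / n!]. *)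
Lemma mass_error_energy0 k : (0 < n)%N ->
  n`!%:R * \sum_(s : 'S_n) mass_error k set0 s ^+ 2
  = n`!%:R * (\sum_(s : 'S_n) alive_mass R k set0 s ^+ 2) - 1.
Proof.
move=> n0; have f0 : n`!%:R != 0 :> R by rewrite pnatr_eq0 -lt0n fact_gt0.
transitivity (n`!%:R * (\sum_(s : 'S_n) (alive_mass R k set0 s ^+ 2
   - 2 / n`!%:R * alive_mass R k set0 s + n`!%:R ^- 2))).
  by congr (_ * _); apply: eq_bigr => s _; rewrite /mass_error eqxx /=; field.
rewrite big_split sumrB /= -mulr_sumr sum_alive_mass // sum_perm_const; field; exact: f0.
Qed.

Lemma alive_mass_dead k B : (0 < k)%N -> B = setT -> \sum_(s : 'S_n) alive_mass R k B s ^+ 2 = 0.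
Proof.
move=> k0 ->; rewrite big1 // => s _; rewrite /alive_mass setCT -(prednK k0) /= /swap_sum.
by rewrite big_set0 mulr0 expr0n.
Qed.

End Distance.

(** * The cutoff bound *)

Lemma sum_by_card (R : nzRingType) n (g : nat -> R) :
  \sum_(B : {set 'I_n}) g #|B| = \sum_(i < n.+1) 'C(n, i)%:R * g i.
Proof.
transitivity (\sum_(i < n.+1) \sum_(B : {set 'I_n} | #|B| == i) g i).
  rewrite (exchange_big_dep xpredT) //=; apply: eq_bigr => B _.
  have Bn : (#|B| < n.+1)%N by rewrite ltnS -[leqRHS]card_ord max_card.
  by rewrite (big_pred1 (Ordinal Bn)) // => i; rewrite -val_eqE /= eq_sym.
apply: eq_bigr => i _.
have -> : 'C(n, i) = #|[set B : {set 'I_n} | #|B| == i]| by rewrite card_draws card_ord.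
by rewrite mulr_natl -sumr_const; apply: eq_bigl => B; rewrite inE.
Qed.

Section Main.
Variable R : realType.

(** The time [4 k] is chosen so that the probability [(1 - i / n) ^ (4 k)] that
    [i] indices survive, at most [expR (- 4 k i / n)], cancels both the
    combinatorial factor [n ^ (2 i)] and the variance factor [q ^ i]. *)
Lemma survival_term_le n i k (q c : R) : (0 < i <= n)%N -> 1 <= q -> 0 < c ->
  4 * k%:R = 2 * n%:R * ln n%:R + n%:R * ln q + 2 * c * n%:R ->
  'C(n, i)%:R * ((n ^_ i)%:R * ((n - i)%:R / n%:R) ^+ (4 * k) * q ^+ i)
    <= expR (- (2 * c)) / i`!%:R.
Proof.
move=> /andP[i0 iN] q1 c0 ek; have n0 : (0 < n)%N by lia.
have n0R : 0 < n%:R :> R by rewrite ltr0n.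
have nN : n%:R != 0 :> R by rewrite gt_eqF.
have q0 : 0 < q by lra.
have f0 : 0 < i`!%:R :> R by rewrite ltr0n fact_gt0.
rewrite ler_pdivlMr //.
have -> : 'C(n, i)%:R * ((n ^_ i)%:R * ((n - i)%:R / n%:R) ^+ (4 * k) * q ^+ i) * i`!%:R
  = (n ^_ i)%:R ^+ 2 * q ^+ i * ((n - i)%:R / n%:R) ^+ (4 * k) :> R.
  have -> : (n ^_ i)%:R ^+ 2 = 'C(n, i)%:R * i`!%:R * (n ^_ i)%:R :> R.
    by rewrite -natrM bin_ffact expr2.
  ring.
apply: (@le_trans _ _ (expR (i%:R * (2 * ln n%:R + ln q)) * expR (- (i%:R / n%:R)) ^+ (4 * k))).
  apply: ler_pM; rewrite ?mulr_ge0 ?exprn_ge0 ?divr_ge0 ?(ltW q0) //.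
    rewrite expRM_natl expRD [expR (2 * _)]expRM_natl !lnK ?posrE // exprMn.
    rewrite ler_wpM2r ?exprn_ge0 ?(ltW q0) // exprAC lerXn2r ?nnegrE ?exprn_ge0 //.
    by rewrite -natrX ler_nat ffact_le_expn.
  rewrite lerXn2r ?nnegrE ?divr_ge0 ?expR_ge0 // natrB // mulrBl divff //.
  exact: one_sub_le_exp.
rewrite -expRM_natl -expRD ler_expR natrM ek.
have -> : i%:R * (2 * ln n%:R + ln q)
    + (2 * n%:R * ln n%:R + n%:R * ln q + 2 * c * n%:R) * - (i%:R / n%:R) = - (2 * c * i%:R).
  by field.
have : 1 <= i%:R :> R by rewrite ler1n.
nra.
Qed.

(** The empty set contributes the random transposition walk on all points. A set
    of [i] indices leaves a walk confined to [n - i] points, for which the given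
    time is more than enough, so its trace is bounded by a constant multiple of
    the top term. *)
Lemma error_l2_bound : exists b : R, 0 <= b /\
  forall (n : nat) (G : finGroupType) (P : G -> R) (x0 : {ffun 'I_n -> G}) (q c : R) (k : nat),
  (0 < n)%N -> 1 <= q -> (forall g, 0 <= 1 / P g - 1 <= q) -> 0 < c -> (0 < k)%N ->
  4 * k%:R = 2 * n%:R * ln n%:R + n%:R * ln q + 2 * c * n%:R ->
  \sum_B (n`!%:R * \sum_s mass_error R k B s ^+ 2) * \prod_(l in B) (1 / P (x0 l) - 1)
    <= b * expR (- (2 * c)).
Proof.
have [b [b0 trb]] := trace_bound R.
exists (b + (1 + b) * expR 1); split.
  by rewrite addr_ge0 // mulr_ge0 ?expR_ge0 // addr_ge0.
move=> n G P x0 q c k n0 q1 Pq c0 k0 ek.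
set e := expR (- (2 * c)).
have e1 : e <= 1 by rewrite expR_le1; lra.
have e0 : 0 <= e by exact: expR_ge0.
have n0R : 0 < n%:R :> R by rewrite ltr0n.
have lnn : 0 <= ln n%:R :> R by rewrite ln_ge0 // ler1n.
have lnq : 0 <= ln q by rewrite ln_ge0.
have energy (B : {set 'I_n}) : (#|B| < n)%N ->
    \tr (swap_mx R (~: B) ^+ (2 * k)) / n%:R ^+ (4 * k)
    <= (n ^_ #|B|)%:R * ((n - #|B|)%:R / n%:R) ^+ (4 * k) * (1 + b * e).
  move=> Bn; have cB : #|~: B| = (n - #|B|)%N by rewrite cardsCs setCK card_ord.
  rewrite ler_pdivrMr ?exprn_gt0 //.
  apply: le_trans (trb _ (~: B) c k c0 k0 _ _) _; rewrite cB ?subn_gt0 //.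
    have jn : (n - #|B|)%:R <= n%:R :> R by rewrite ler_nat leq_subr.
    have j1 : 1 <= (n - #|B|)%:R :> R by rewrite ler1n subn_gt0.
    have lnj : ln (n - #|B|)%:R <= ln n%:R :> R by rewrite ler_ln ?posrE //; lra.
    have : (n - #|B|)%:R * ln (n - #|B|)%:R <= n%:R * ln n%:R :> R.
      by apply: ler_pM => //; rewrite ln_ge0.
    have : c * (n - #|B|)%:R <= c * n%:R by rewrite ler_wpM2l // ltW.
    have : 0 <= n%:R * ln q by rewrite mulr_ge0.
    rewrite natrM; lra.
  rewrite card_ord -(ffact_fact (ltnW Bn)) natrM mulfK ?pnatr_eq0 -?lt0n ?fact_gt0 //.
  rewrite expr_div_n; apply: le_of_eq.
  have M0 : n%:R ^+ (4 * k) != 0 :> R by rewrite expf_neq0 // gt_eqF.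
  rewrite -/e; move: (n%:R ^+ (4 * k)) ((n - #|B|)%:R ^+ (4 * k)) M0 => M1 M2 M0.
  by field.
pose g i := if i == 0%N then b * e else
  (n ^_ i)%:R * ((n - i)%:R / n%:R) ^+ (4 * k) * q ^+ i * (1 + b).
apply: (@le_trans _ _ (\sum_(B : {set 'I_n}) g #|B|)).
  apply: ler_sum => B _; rewrite /g; have [->|B0] := eqVneq B set0.
    rewrite big_set0 mulr1 cards0 eqxx mass_error_energy0 // alive_mass_energy //.
    have := energy set0; rewrite cards0 subn0 ffactn0 divff ?gt_eqF // expr1n !mul1r.
    by move=> /(_ n0) h; rewrite lerBlDr addrC.
  rewrite cards_eq0 (negPf B0).
  have pq : 0 <= \prod_(l in B) (1 / P (x0 l) - 1) <= q ^+ #|B|.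
    rewrite prodr_ge0 /=; last by move=> l _; case/andP: (Pq (x0 l)).
    rewrite -prodr_const; apply: ler_prod => l _; exact: Pq.
  have -> : \sum_s mass_error R k B s ^+ 2 = \sum_(s : 'S_n) alive_mass R k B s ^+ 2.
    by apply: eq_bigr => s _; rewrite /mass_error (negPf B0) mul0r subr0.
  have h0 : 0 <= (n ^_ #|B|)%:R * ((n - #|B|)%:R / n%:R) ^+ (4 * k) :> R.
    by rewrite mulr_ge0 ?exprn_ge0 ?divr_ge0.
  have [Bn|Bn] := ltnP #|B| n; last first.
    have -> : \sum_(s : 'S_n) alive_mass R k B s ^+ 2 = 0.
      apply: alive_mass_dead => //; apply/eqP; rewrite eqEcard subsetT.
      by rewrite cardsT card_ord.
    by rewrite mulr0 mul0r !mulr_ge0 ?exprn_ge0 ?divr_ge0 ?addr_ge0 //; lra.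
  rewrite alive_mass_energy // -mulrA [q ^+ _ * _]mulrC mulrA.
  case/andP: pq => p0 pq; apply: ler_pM => //.
    rewrite -alive_mass_energy // mulr_ge0 // sumr_ge0 // => s _; exact: sqr_ge0.
  apply: le_trans (energy _ Bn) _; rewrite ler_wpM2l // lerD2l.
  by rewrite -[leRHS]mulr1 ler_wpM2l.
rewrite sum_by_card big_ord_recl /= {1}/g /= bin0 mul1r mulrDl lerD2l.
apply: (@le_trans _ _ (\sum_(i < n) (1 + b) * e * (1 ^+ i.+1 / i.+1`!%:R))).
  apply: ler_sum => i _; rewrite /g /= expr1n mul1r.
  have := @survival_term_le n i.+1 k q c; rewrite (ltn_ord i) => /(_ isT q1 c0 ek).
  move=> /(ler_wpM2l (_ : 0 <= 1 + b)) h; have b1 : 0 <= 1 + b by rewrite addr_ge0.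
  apply: le_trans (le_trans _ (h b1)) _; apply: le_of_eq; rewrite -/e; ring.
rewrite -mulr_sumr mulrAC ler_wpM2r // ler_wpM2l ?addr_ge0 //.
apply: le_trans (sum_exp_coeff_le n.+1 ler01).
by rewrite big_ord_recl lerDr expr0 fact0 divr1.
Qed.

End Main.

Theorem corollary2p8 (R : realType) :
  exists b : R, 0 < b /\
  forall (n : nat) (G : finGroupType) (P : G -> R) (x0 : {ffun 'I_n -> G}),
    (1 <= n)%N -> (2 <= #|G|)%N -> is_prob P -> 0 < p_min P ->
  forall (c : R) (k : nat),
    0 < c ->
    k%:R = 1 / 2 * n%:R * ln n%:R
           + 1 / 4 * n%:R * ln (1 / p_min P - 1)
           + 1 / 2 * c * n%:R :> R ->
  let Pk := kernel_iter (transition P (@Qhat n R)) k (x0, 1%g) in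
  let Pinf := @stationary R n G P in
  tv_dist Pk Pinf <= 1 / 2 * l2_norm Pinf (fun w => Pk w - Pinf w) /\
  1 / 2 * l2_norm Pinf (fun w => Pk w - Pinf w) <= b * expR (- c).
Proof.
have [b [b0 l2b]] := error_l2_bound R.
exists (Num.sqrt b / 2 + 1); split; first by rewrite ltr_wpDl // divr_ge0 ?sqrtr_ge0.
move=> n G P x0 n0 G2 [Pge P1] pm0 c k c0 ek Pk Pinf.
have pmin_le g : p_min P <= P g by exact: bigmin_le.
have P0 g : 0 < P g by apply: lt_le_trans pm0 (pmin_le g).
have Ple1 g : P g <= 1 by rewrite -P1 (bigD1 g) //= lerDl sumr_ge0.
have pm2 : 2 * p_min P <= 1.
  rewrite -[leRHS]P1; apply: (@le_trans _ _ (\sum_(g : G) p_min P)); last exact: ler_sum.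
  by rewrite sumr_const -[leRHS]mulr_natl ler_wpM2r ?ler_nat // ltW.
have q1 : 1 <= 1 / p_min P - 1 by rewrite lerBrDr ler_pdivlMr //; lra.
have Pq g : 0 <= 1 / P g - 1 <= 1 / p_min P - 1.
  rewrite subr_ge0 lerD2r !div1r invf_ge1 // Ple1 /=.
  by rewrite lef_pV2 ?posrE.
have n0R : 0 < n%:R :> R by rewrite ltr0n.
have lnn : 0 <= ln n%:R :> R by rewrite ln_ge0 // ler1n.
have lnq : 0 <= ln (1 / p_min P - 1) by rewrite ln_ge0.
have k0 : (0 < k)%N.
  rewrite -(ltr_nat R) ek.
  have := mulr_ge0 (ltW n0R) lnn; have := mulr_ge0 (ltW n0R) lnq.
  have := mulr_gt0 c0 n0R; lra.
have sumPk : \sum_w Pk w = \sum_w Pinf w.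
  apply/eqP; rewrite -subr_eq0 -sumrB sum_law_error // sum_mass_error0 //.
split.
  apply: tv_le_l2 => //; [exact: stationary_gt0 | exact: sum_stationary].
rewrite /l2_norm law_error_l2 //.
have -> : expR (- c) = Num.sqrt (expR (- (2 * c))).
  have -> : expR (- (2 * c)) = expR (- c) ^+ 2 by rewrite -expRM_natl mulrN.
  by rewrite sqrtr_sqr ger0_norm ?expR_ge0.
apply: (@le_trans _ _ (1 / 2 * Num.sqrt (b * expR (- (2 * c))))).
  rewrite ler_wpM2l ?divr_ge0 // ler_wsqrtr //.
  by apply: (l2b _ _ _ _ (1 / p_min P - 1)) => //; rewrite ek; lra.
rewrite sqrtrM // mulrA ler_wpM2r ?sqrtr_ge0 //; lra.
Qed.
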